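(* Let $z$ be a random real that computes a proper pruned tree $T$ such that \[ \log|T\cap 2^n|\geq 2\log\log|T\cap 2^n|+\mathsf{d}(T\cap 2^n) \] for all $n$ with $|T\cap 2^n|\geq 2$. Then $z\geq_T\emptyset'$.
   Context: $2^{<\omega}$ is the set of finite binary strings, $2^n$ the set of $n$-bit strings; reals are infinite binary sequences. $K$ is prefix-free Kolmogorov complexity; $\log$ is base 2. ''Random'' means Martin-Löf random; $\leq_T$ is Turing reducibility; $\emptyset'$ is the halting problem. A tree is a nonempty set $T\subseteq 2^{<\omega}$ that is downward-closed under the prefix relation $\preceq$. $T$ is pruned if it has no $\preceq$-maximal element, and proper if $n\mapsto|T\cap 2^n|$ is unbounded. For a set $E$ of strings, $\mathsf{d}(E)=\sup_{\sigma\in E}(|\sigma|-K(\sigma))$. ''$z$ computes $T$'' means $T\leq_T z$. *)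

(* Defs.v *)
From HB Require Import structures.
From mathcomp Require Import all_boot all_order all_algebra.
From mathcomp Require Import all_classical all_reals all_analysis.

Set Implicit Arguments.
Unset Strict Implicit.
Unset Printing Implicit Defensive.

Import Order.TTheory GRing.Theory Num.Theory.
Import numFieldNormedType.Exports.

Local Open Scope classical_set_scope.

(** ** Oracle computability *)

(* Cantor's bijection nat * nat -> nat. *)
Definition cpair (x y : nat) : nat := 'C((x + y).+1, 2) + y.

(* Programs for the unary partial functions that are recursive relative to an
   oracle; further arguments are passed through [cpair]. *)
Inductive prog : Type :=
  | Zero | Succ | Left | Right | Oracle
  | Pair of prog & prog
  | Comp of prog & prog
  | Prec of prog & prog
  | Mu of prog.

Fixpoint prec_graph (base step : nat -> nat -> Prop) (a n y : nat) : Prop :=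
  if n is k.+1
  then exists2 r, prec_graph base step a k r & step (cpair a (cpair k r)) y
  else base a y.

(* [oracle_eval A e x y]: the program [e] with oracle [A] halts on input [x]
   with output [y].  The bit [A x] is used as a number through [nat_of_bool]. *)
Fixpoint oracle_eval (A : nat -> bool) (e : prog) (x y : nat) : Prop :=
  match e with
  | Zero => y = 0
  | Succ => y = x.+1
  | Left => exists b, x = cpair y b
  | Right => exists a, x = cpair a y
  | Oracle => y = A x
  | Pair f g =>
      exists u v, [/\ oracle_eval A f x u, oracle_eval A g x v & y = cpair u v]
  | Comp f g => exists2 u, oracle_eval A g x u & oracle_eval A f u y
  | Prec f g =>
      exists a n, x = cpair a n /\
        prec_graph (oracle_eval A f) (oracle_eval A g) a n y
  | Mu f =>
      oracle_eval A f (cpair x y) 0 /\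
      forall k, k < y -> exists m, oracle_eval A f (cpair x k) m.+1
  end.

Definition halts (A : nat -> bool) (e : prog) (x : nat) : Prop :=
  exists y, oracle_eval A e x y.

(* Goedel numbering: a bijection from programs to natural numbers. *)
Fixpoint prog_num (e : prog) : nat :=
  match e with
  | Zero => 0
  | Succ => 1
  | Left => 2
  | Right => 3
  | Oracle => 4
  | Pair f g => 5 + 4 * cpair (prog_num f) (prog_num g)
  | Comp f g => 6 + 4 * cpair (prog_num f) (prog_num g)
  | Prec f g => 7 + 4 * cpair (prog_num f) (prog_num g)
  | Mu f => 8 + 4 * prog_num f
  end.

Definition charf (S : set nat) : nat -> bool := fun n => `[< S n >].

Definition no_oracle : nat -> bool := fun=> false.

Definition turing_le (A B : nat -> bool) : Prop :=
  exists e, forall n, oracle_eval B e n (A n).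

Definition halting_problem : set nat :=
  [set prog_num e | e in [set e | halts no_oracle e (prog_num e)]].

Definition comp_enum (S : set nat) : Prop :=
  exists e, S = [set n | halts no_oracle e n].

(* Length-lexicographic numbering (bijective base 2): a bijection from strings
   to natural numbers. *)
Definition str_num (s : bitseq) : nat :=
  foldl (fun (n : nat) (b : bool) => n.*2 + b.+1) 0 s.

(** ** Prefix-free complexity *)

Definition machine (M : prog) (s t : bitseq) : Prop :=
  oracle_eval no_oracle M (str_num s) (str_num t).

Definition prefix_free_machine (M : prog) : Prop :=
  forall s s', halts no_oracle M (str_num s) ->
    halts no_oracle M (str_num s') -> prefix s s' -> s = s'.

Definition optimal_prefix_free_machine (U : prog) : Prop :=
  prefix_free_machine U /\
  forall M, prefix_free_machine M ->
    exists c, forall s t, machine M s t ->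
      exists2 s', machine U s' t & size s' <= size s + c.

Local Open Scope ring_scope.
Local Open Scope ereal_scope.

(* An infimum of natural numbers, so a minimum when [t] has a description, as
   it does whenever [U] is optimal. *)
Definition complexity (R : realType) (U : prog) (t : bitseq) : \bar R :=
  ereal_inf [set (size s)%:R%:E | s in [set s | machine U s t]].

Definition deficiency (R : realType) (U : prog) (E : set bitseq) : \bar R :=
  ereal_sup [set (size s)%:R%:E - complexity R U s | s in E].

(** ** Martin-Loef randomness *)

Definition cylinder (s : bitseq) : set (nat -> bool) :=
  [set x | mkseq x (size s) = s].

(* The uniform (fair-coin) measure on infinite binary sequences, as the outer
   measure generated by the lengths of cylinders. *)
Definition coin_measure (R : realType) (X : set (nat -> bool)) : \bar R :=
  ereal_inf [set \esum_(s in C) ((2^-1 : R) ^+ size s)%:E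
            | C in [set C : set bitseq | X `<=` \bigcup_(s in C) cylinder s]].

Definition open_of (V : set bitseq) : set (nat -> bool) :=
  \bigcup_(s in V) cylinder s.

Definition ML_test (R : realType) (V : nat -> set bitseq) : Prop :=
  comp_enum [set k | exists i s, V i s /\ k = cpair i (str_num s)] /\
  forall i, coin_measure R (open_of (V i)) <= ((2^-1 : R) ^+ i)%:E.

Definition ML_random (R : realType) (z : nat -> bool) : Prop :=
  forall V, ML_test R V -> ~ (\bigcap_i open_of (V i)) z.

(** ** Trees *)

Definition tree (T : set bitseq) : Prop :=
  T !=set0 /\ forall s t, prefix s t -> T t -> T s.

Definition pruned (T : set bitseq) : Prop :=
  ~ exists2 s, T s & forall t, T t -> prefix s t -> t = s.

Definition level (T : set bitseq) (n : nat) : set bitseq :=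
  T `&` [set s | size s = n].

Definition level_card (T : set bitseq) (n : nat) : nat :=
  #|[pred t : n.-tuple bool | `[< T t >]]|.

Definition proper_tree (T : set bitseq) : Prop :=
  forall m, exists n, (m < level_card T n)%N.

Definition computes_tree (z : nat -> bool) (T : set bitseq) : Prop :=
  turing_le (charf (str_num @` T)) z.

Definition log2 (R : realType) (x : R) : R := (ln x / ln 2)%R.

(* Main.v *)
Require Import Defs.
From mathcomp Require Import all_boot all_order all_algebra.
From mathcomp Require Import all_classical all_reals all_analysis.
From mathcomp Require Import zify lra.

(** If [i] enters the halting problem at stage [n], wait for oracles to
    converge on level [n] of their trees, and compress a string [s] of length
    [n] as soon as enough oracles (in measure) have a level of about [2 ^ m]
    strings containing [s] and no compressed string yet.  Each selection hits
    new oracles, so the total weight of the selections is bounded by the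
    measure of Cantor space and they can be coded by consecutive intervals; at
    any time the oracles still waiting to be hit have measure at most
    [2 ^ - i], by double counting the pairs (oracle, string of its level).
    The weights are chosen as [2 ^ m / m ^ 2], up to a factor depending on
    [i], so that the bounds are summable over [m].  The term [2 log log] of
    the hypothesis pays for the factor [m ^ 2]: the strings in the tree of [z]
    are too complex to be selected, except for finitely many [i].

    Call [i] late if level [n] of the tree has at least
    [2 ^ 2 ^ (3 * i + 2)] strings.  If finitely many [i] are late, [z] bounds
    the stage at which [i] enters by finding a level that large.  Otherwise
    [z] finds arbitrarily large late [i], for which it waits forever.  If [j]
    entered the halting problem after such a wait for some [i > j] has begun,
    then [z] would be waiting at the stage where [j] enters, an event of
    measure at most [2 ^ - j]; by randomness this happens for finitely many
    [j] only. *)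

Set Implicit Arguments.
Unset Strict Implicit.
Unset Printing Implicit Defensive.

Import Order.TTheory GRing.Theory Num.Theory.

Local Open Scope nat_scope.

(** * Cantor pairing and determinism of oracle programs *)

Lemma cpair_succ (a b : nat) : cpair a b.+1 = (cpair a.+1 b).+1.
Proof. by rewrite /cpair addnS addSn addnS. Qed.

Lemma cpair_succ0 (b : nat) : cpair b.+1 0 = (cpair 0 b).+1.
Proof.
by rewrite /cpair addn0 add0n addn0 binS bin1 addnC; rewrite -addnS addnC.
Qed.

(** The successor of a code is the code of the next pair on the same diagonal, or of the first pair
    on the next diagonal. *)
Lemma cpair_surj (x : nat) : exists a b, x = cpair a b.
Proof.
elim: x => [|x [[|a] [b ->]]]; first by exists 0, 0.
- by exists b.+1, 0; rewrite cpair_succ0.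
- by exists a, b.+1; rewrite cpair_succ.
Qed.

(** The offset [b] on the diagonal of sum [a + b] is at most that sum, so the codes of this diagonal
    end before the first code of the next one. *)
Lemma cpair_lt_diag (a b c d : nat) : a + b < c + d -> cpair a b < cpair c d.
Proof.
move=> h; rewrite /cpair.
apply: (@leq_trans ('C((a + b).+2, 2))).
  by rewrite [in X in _ < X]binS bin1 ltn_add2l ltnS leq_addl.
by apply: leq_trans (leq_addr _ _); apply: leq_bin2l.
Qed.

Lemma cpair_inj (a b c d : nat) : cpair a b = cpair c d -> a = c /\ b = d.
Proof.
move=> h; have e : a + b = c + d.
  by case: (ltngtP (a + b) (c + d)) => // /cpair_lt_diag; rewrite h ltnn.
have hbd : b = d by move: h; rewrite /cpair e => /addnI.
by split=> //; move: e; rewrite hbd => /addIn.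
Qed.

Lemma leq_cpair (a b : nat) : (a <= cpair a b) && (b <= cpair a b).
Proof.
rewrite /cpair leq_addl andbT (leq_trans _ (leq_addr _ _))//.
apply: (leq_trans (leq_addr b a)).
by rewrite binS bin1 leq_addl.
Qed.

Lemma leq_cpairl (a b : nat) : a <= cpair a b.
Proof. by case/andP: (leq_cpair a b). Qed.

Lemma leq_cpairr (a b : nat) : b <= cpair a b.
Proof. by case/andP: (leq_cpair a b). Qed.

Lemma oracle_eval_fun (A : nat -> bool) (e : prog) (x y y' : nat) :
  oracle_eval A e x y -> oracle_eval A e x y' -> y = y'.
Proof.
elim: e x y y' => [||||| f IHf g IHg | f IHf g IHg | f IHf g IHg | f IHf] x y y' /=.
- by move=> -> ->.
- by move=> -> ->.
- by move=> [b ->] [b' /cpair_inj[]].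
- by move=> [b ->] [b' /cpair_inj[]].
- by move=> -> ->.
- by move=> [u [v [hu hv ->]]] [u' [v' [/(IHf _ _ _ hu)<- /(IHg _ _ _ hv)<- ->]]].
- by move=> [u hu hy] [u' /(IHg _ _ _ hu)<- /(IHf _ _ _ hy)].
- move=> [a [n [-> h]]] [a' [n' [/cpair_inj[<- <-]]]].
  elim: n y y' h => [|n IHn] y y' /=; first exact: IHf.
  by move=> [r hr hy] [r' /(IHn _ _ hr)<-]; exact: IHg.
- move=> [h0 h] [h0' h']; case: (ltngtP y y') => // lt.
  + by have [m /(IHf _ _ _ h0)] := h' _ lt.
  + by have [m /(IHf _ _ _ h0')] := h _ lt.
Qed.

(** * Computable functions between coded types *)

(* [dflt] is the junk value of [head] on the empty sequence. *)
Class codable (T : Type) := Codable {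
  enc : T -> nat;
  enc_inj : injective enc;
  dflt : T }.

#[global] Instance codable_nat : codable nat := Codable (@inj_id nat) 0.

Lemma nat_of_bool_inj : injective nat_of_bool.
Proof. by case; case. Qed.

#[global] Instance codable_bool : codable bool := Codable nat_of_bool_inj false.

Section CodableProdSeq.
Context {S T : Type} {cS : codable S} {cT : codable T}.

Definition enc_pair (p : S * T) : nat := cpair (enc p.1) (enc p.2).

Lemma enc_pair_inj : injective enc_pair.
Proof.
move=> [a b] [c d] h; have [h1 h2] := cpair_inj h.
by congr pair; [exact: enc_inj h1 | exact: enc_inj h2].
Qed.

Definition enc_seq (s : seq T) : nat :=
  foldr (fun x k => (cpair (enc x) k).+1) 0 s.

Lemma enc_seq_inj : injective enc_seq.
Proof.
elim=> [|a s IH] [|b t] //= [h]; have [h1 h2] := cpair_inj h.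
by rewrite (enc_inj h1) (IH _ h2).
Qed.

#[global] Instance codable_prod : codable (S * T) :=
  Codable enc_pair_inj (dflt, dflt).

#[global] Instance codable_seq : codable (seq T) := Codable enc_seq_inj [::].

End CodableProdSeq.

(* Uniform in the oracle, so that the program may be run with any of them. *)
Definition computable S T {cS : codable S} {cT : codable T} (f : S -> T) : Prop :=
  exists e, forall A x, oracle_eval A e (enc x) (enc (f x)).

Lemma eq_cf {S T : Type} {cS : codable S} {cT : codable T}
    (f g : S -> T) : computable f -> f =1 g -> computable g.
Proof. by move=> [e he] fg; exists e => A x; rewrite -fg. Qed.

(** Splitting a number into its two components and pairing them again restores it, as every number
    is the code of a pair. *)
Lemma cf_id {S : Type} {cS : codable S}
    : computable (fun x : S => x).
Proof.
exists (Pair Left Right) => A x /=.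
have [a [b ->]] := cpair_surj (enc x).
by exists a, b; split=> //; [exists b | exists a].
Qed.

Lemma cf_enc {G T : Type} {cG : codable G} {cT : codable T}
    (f : G -> T) : computable f -> computable (fun x => enc (f x)).
Proof. by []. Qed.

Lemma cf_const {S T : Type} {cS : codable S} {cT : codable T}
    (c : T) : computable (fun _ : S => c).
Proof.
rewrite /computable; move: (enc c) => n; elim: n => [|n [e he]]; first by exists Zero.
by exists (Comp Succ e) => A x /=; exists n.
Qed.

Lemma cf_comp {G S T : Type} {cG : codable G} {cS : codable S} {cT : codable T}
    (g : S -> T) (f : G -> S) :
  computable g -> computable f -> computable (fun x => g (f x)).
Proof.
by move=> [eg hg] [ef hf]; exists (Comp eg ef) => A x /=; exists (enc (f x)).
Qed.

Lemma cf_pair {G S T : Type} {cG : codable G} {cS : codable S} {cT : codable T}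
    (f : G -> S) (g : G -> T) :
  computable f -> computable g -> computable (fun x => (f x, g x)).
Proof.
move=> [ef hf] [eg hg]; exists (Pair ef eg) => A x /=.
by exists (enc (f x)), (enc (g x)).
Qed.

Lemma cf_fst {G S T : Type} {cG : codable G} {cS : codable S} {cT : codable T}
    (f : G -> S * T) : computable f -> computable (fun x => (f x).1).
Proof.
move=> [e he]; exists (Comp Left e) => A x /=.
by exists (enc (f x)) => //=; exists (enc (f x).2).
Qed.

Lemma cf_snd {G S T : Type} {cG : codable G} {cS : codable S} {cT : codable T}
    (f : G -> S * T) : computable f -> computable (fun x => (f x).2).
Proof.
move=> [e he]; exists (Comp Right e) => A x /=.
by exists (enc (f x)) => //=; exists (enc (f x).1).
Qed.

Lemma cf_iteri {G T : Type} {cG : codable G} {cT : codable T}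
    (n : G -> nat) (s : G -> nat -> T -> T) (z : G -> T) :
  computable n -> computable (fun p : G * (nat * T) => s p.1 p.2.1 p.2.2) ->
  computable z ->
  computable (fun x => iteri (n x) (s x) (z x)).
Proof.
move=> [en hn] [es hs] [ez hz].
(* [Pair Left Right] is the identity, so the inner program produces the code of [(x, n x)], the form
   of input that [Prec] expects. *)
exists (Comp (Prec ez es) (Pair (Pair Left Right) en)) => A x /=.
exists (cpair (enc x) (n x)).
  have [a [b e]] := cpair_surj (enc x).
  exists (enc x), (n x); split=> //.
  by exists a, b; split=> //; [exists b | exists a].
exists (enc x), (n x); split=> //.
elim: (n x) => [|k IH] /=; first exact: hz.
exists (enc (iteri k (s x) (z x))) => //.
exact: (hs A (x, (k, iteri k (s x) (z x)))).
Qed.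

Lemma cf_succ {G : Type} {cG : codable G}
    (f : G -> nat) : computable f -> computable (fun x => (f x).+1).
Proof.
by move=> [e he]; exists (Comp Succ e) => A x /=; exists (f x) => //; exact: he.
Qed.

Lemma cf_if {G T : Type} {cG : codable G} {cT : codable T}
    (b : G -> bool) (f g : G -> T) :
  computable b -> computable f -> computable g ->
  computable (fun x => if b x then f x else g x).
Proof.
move=> hb hf hg.
apply: (@eq_cf _ _ _ _ (fun x => iteri (enc (b x)) (fun _ _ => f x) (g x))).
  apply: cf_iteri => //.
  exact: (cf_comp hf (cf_fst (cf_id))).
by move=> x; case: (b x).
Qed.

Lemma cf_pred {G : Type} {cG : codable G}
    (f : G -> nat) : computable f -> computable (fun x => (f x).-1).
Proof.
move=> hf; apply: (@eq_cf _ _ _ _ (fun x => iteri (f x) (fun k _ => k) 0)).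
  by apply: cf_iteri => //; [exact: cf_fst (cf_snd cf_id)|exact: cf_const].
by move=> x; case: (f x).
Qed.

Lemma cf_iter {G T : Type} {cG : codable G} {cT : codable T}
    (n : G -> nat) (s : G -> T -> T) (z : G -> T) :
  computable n -> computable (fun p : G * T => s p.1 p.2) -> computable z ->
  computable (fun x => iter (n x) (s x) (z x)).
Proof.
move=> hn hs hz.
apply: (@eq_cf _ _ _ _ (fun x => iteri (n x) (fun _ => s x) (z x))).
  apply: cf_iteri => //.
  apply: (cf_comp (f := fun p : G * (nat * T) => (p.1, p.2.2)) hs).
  by apply: cf_pair; [exact: cf_fst cf_id | exact: cf_snd (cf_snd cf_id)].
by move=> x; elim: (n x) => //= k ->.
Qed.

Lemma cf_add {G} {cG : codable G} (f g : G -> nat) :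
  computable f -> computable g -> computable (fun x => f x + g x).
Proof.
move=> hf hg; apply: (@eq_cf _ _ _ _ (fun x => iter (g x) succn (f x))).
  by apply: cf_iter => //; exact: cf_succ (cf_snd cf_id).
by move=> x; rewrite iter_succn.
Qed.

Lemma cf_sub {G} {cG : codable G} (f g : G -> nat) :
  computable f -> computable g -> computable (fun x => f x - g x).
Proof.
move=> hf hg; apply: (@eq_cf _ _ _ _ (fun x => iter (g x) predn (f x))).
  by apply: cf_iter => //; exact: cf_pred (cf_snd cf_id).
by move=> x; rewrite iter_predn.
Qed.

Lemma cf_mul {G} {cG : codable G} (f g : G -> nat) :
  computable f -> computable g -> computable (fun x => f x * g x).
Proof.
move=> hf hg; apply: (@eq_cf _ _ _ _ (fun x => iter (g x) (addn (f x)) 0)).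
  apply: (cf_iter (s := fun x k => f x + k)) (cf_const _) => //.
  by apply: cf_add; [exact: cf_comp hf (cf_fst cf_id) | exact: cf_snd cf_id].
by move=> x; rewrite iter_addn_0.
Qed.

Lemma cf_exp {G} {cG : codable G} (f g : G -> nat) :
  computable f -> computable g -> computable (fun x => f x ^ g x).
Proof.
move=> hf hg; apply: (@eq_cf _ _ _ _ (fun x => iter (g x) (muln (f x)) 1)).
  apply: (cf_iter (s := fun x k => f x * k)) (cf_const _) => //.
  by apply: cf_mul; [exact: cf_comp hf (cf_fst cf_id) | exact: cf_snd cf_id].
by move=> x; rewrite iter_muln_1.
Qed.

Lemma cf_leq {G} {cG : codable G} (f g : G -> nat) :
  computable f -> computable g -> computable (fun x => f x <= g x).
Proof.
move=> hf hg.
apply: (@eq_cf _ _ _ _ (fun x => iter (f x - g x) (fun=> false) true)).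
  by apply: cf_iter; [exact: cf_sub | exact: cf_const | exact: cf_const].
by move=> x; rewrite -subn_eq0; case: (f x - g x).
Qed.

Lemma cf_and {G} {cG : codable G} (a b : G -> bool) :
  computable a -> computable b -> computable (fun x => a x && b x).
Proof. by move=> ha hb; apply: cf_if => //; exact: cf_const. Qed.

Lemma cf_or {G} {cG : codable G} (a b : G -> bool) :
  computable a -> computable b -> computable (fun x => a x || b x).
Proof. by move=> ha hb; apply: cf_if => //; exact: cf_const. Qed.

Lemma cf_neg {G} {cG : codable G} (a : G -> bool) :
  computable a -> computable (fun x => ~~ a x).
Proof. by move=> ha; apply: cf_if => //; exact: cf_const. Qed.

Lemma cf_eq {G} {cG : codable G} (T : eqType) (cT : codable T) (f g : G -> T) :
  computable f -> computable g -> computable (fun x => f x == g x).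
Proof.
move=> hf hg.
apply: (@eq_cf _ _ _ _
  (fun x => (enc (f x) <= enc (g x)) && (enc (g x) <= enc (f x)))).
  by apply: cf_and; apply: cf_leq; apply: cf_enc.
by move=> x; rewrite -eqn_leq (inj_eq enc_inj).
Qed.

Lemma cf_cpair {G} {cG : codable G} (f g : G -> nat) :
  computable f -> computable g -> computable (fun x => cpair (f x) (g x)).
Proof. exact: cf_pair. Qed.

Lemma cf_cons {G T : Type} {cG : codable G} {cT : codable T}
    (f : G -> T) (g : G -> seq T) :
  computable f -> computable g -> computable (fun x => f x :: g x).
Proof.
move=> hf hg; have [e he] := cf_succ (cf_cpair (cf_enc hf) (cf_enc hg)).
by exists e.
Qed.

Lemma cf_behead {G T : Type} {cG : codable G} {cT : codable T}
    (f : G -> seq T) : computable f -> computable (fun x => behead (f x)).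
Proof.
move=> hf; have [e he] := cf_pred (cf_enc hf).
exists (Comp Right e) => A x; exists (enc (f x)).-1; first exact: he.
(* The empty sequence has code [0], which is its own predecessor and the code of [(0, 0)], so it is
   sent to itself. *)
by case: (f x) => [|a s] /=; [exists 0 | exists (enc a)].
Qed.

Lemma cf_head {G T : Type} {cG : codable G} {cT : codable T}
    (f : G -> seq T) : computable f -> computable (fun x => head dflt (f x)).
Proof.
move=> hf; have [e he] := cf_pred (cf_enc hf).
pose g x := if f x is a :: s then @enc T cT a else 0.
have hg : computable g.
  exists (Comp Left e) => A x; exists (enc (f x)).-1; first exact: he.
  by rewrite /g; case: (f x) => [|a s] /=; [exists 0 | exists (enc_seq s)].
have h : computable (fun x => if 0 < enc (f x) then g x else enc (dflt : T)).
  apply: cf_if => //; last exact: cf_const.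
  by apply: cf_leq; [exact: cf_const|exact: cf_enc].
have [e' he'] : computable (fun x => enc (head dflt (f x))).
  by apply: eq_cf h _ => x; rewrite /g; case: (f x).
by exists e'.
Qed.

(** The fold is an iteration on pairs of remaining list and accumulator. The code of a list is at
    least its length, so it can serve as the number of iterations; once the list is exhausted,
    further ones change nothing. *)
Lemma cf_foldl {G S T : Type} {cG : codable G} {cS : codable S} {cT : codable T}
    (s : G -> seq S) (f : G -> T -> S -> T) (z : G -> T) :
  computable s -> computable (fun p : G * (T * S) => f p.1 p.2.1 p.2.2) ->
  computable z ->
  computable (fun x => foldl (f x) (z x) (s x)).
Proof.
move=> hs hf hz.
pose step x (p : seq S * T) : seq S * T :=
  if p.1 is a :: l then (l, f x p.2 a) else p.
have hstep : computable (fun p : G * (seq S * T) => step p.1 p.2).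
  have h1 : computable (fun p : G * (seq S * T) => p.2.1).
    by exact: cf_fst (cf_snd cf_id).
  have h : computable (fun p : G * (seq S * T) => if 0 < enc p.2.1
      then (behead p.2.1, f p.1 p.2.2 (head dflt p.2.1)) else p.2).
    apply: cf_if; last exact: cf_snd cf_id.
    - by apply: cf_leq; [exact: cf_const | exact: cf_enc].
    - apply: cf_pair; first exact: cf_behead.
      apply: (cf_comp (f := fun p : G * (seq S * T) =>
        (p.1, (p.2.2, head dflt p.2.1))) hf).
      apply: cf_pair; first exact: cf_fst cf_id.
      by apply: cf_pair; [exact: cf_snd (cf_snd cf_id) | exact: cf_head].
  by apply: eq_cf h _ => -[x [[|a l] w]].
have h : computable (fun x => (iter (enc (s x)) (step x) (s x, z x)).2).
  by apply: cf_snd; apply: cf_iter => //; exact: cf_pair.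
apply: eq_cf h _ => x; have : size (s x) <= enc (s x).
  elim: (s x) => //= a l IH; rewrite ltnS; exact: leq_trans IH (leq_cpairr _ _).
move: (enc (s x)) => k; elim: k (s x) (z x) => [|k IH] [|a l] w //.
  move=> _; suff -> : iter k.+1 (step x) ([::], w) = ([::], w) by [].
  by elim: k.+1 => //= j ->.
by rewrite ltnS iterSr => h; exact: IH h.
Qed.

Lemma cf_rev {G T : Type} {cG : codable G} {cT : codable T}
    (s : G -> seq T) : computable s -> computable (fun x => rev (s x)).
Proof.
move=> hs.
apply: (@eq_cf _ _ _ _ (fun x => foldl (fun l a => a :: l) [::] (s x))).
  apply: cf_foldl => //; last exact: cf_const.
  by apply: cf_cons; [exact: cf_snd (cf_snd cf_id) | exact: cf_fst (cf_snd cf_id)].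
move=> x; rewrite -[in LHS](revK (s x)) foldl_rev.
by elim: (rev _) => //= a l ->.
Qed.

Lemma cf_foldr {G S T : Type} {cG : codable G} {cS : codable S} {cT : codable T}
    (s : G -> seq S) (f : G -> S -> T -> T) (z : G -> T) :
  computable s -> computable (fun p : G * (T * S) => f p.1 p.2.2 p.2.1) ->
  computable z ->
  computable (fun x => foldr (f x) (z x) (s x)).
Proof.
move=> hs hf hz.
apply: (@eq_cf _ _ _ _ (fun x => foldl (fun l a => f x a l) (z x) (rev (s x)))).
  by apply: cf_foldl => //; exact: cf_rev.
by move=> x; rewrite foldl_rev.
Qed.

Lemma cf_cat {G T : Type} {cG : codable G} {cT : codable T}
    (f g : G -> seq T) :
  computable f -> computable g -> computable (fun x => f x ++ g x).
Proof.
move=> hf hg.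
apply: (@eq_cf _ _ _ _ (fun x => foldr (fun a l => a :: l) (g x) (f x))).
  apply: cf_foldr => //.
  by apply: cf_cons; [exact: cf_snd (cf_snd cf_id) | exact: cf_fst (cf_snd cf_id)].
by move=> x; elim: (f x) => //= a l ->.
Qed.

Lemma cf_map {G S T : Type} {cG : codable G} {cS : codable S} {cT : codable T}
    (s : G -> seq S) (f : G -> S -> T) :
  computable s -> computable (fun p : G * S => f p.1 p.2) ->
  computable (fun x => map (f x) (s x)).
Proof.
move=> hs hf.
apply: (@eq_cf _ _ _ _ (fun x => foldr (fun a l => f x a :: l) [::] (s x))).
  apply: cf_foldr; [done | | exact: cf_const].
  apply: cf_cons; last exact: cf_fst (cf_snd cf_id).
  apply: (cf_comp (f := fun p : G * (seq T * S) => (p.1, p.2.2)) hf).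
  by apply: cf_pair; [exact: cf_fst cf_id | exact: cf_snd (cf_snd cf_id)].
by move=> x; elim: (s x) => //= a l ->.
Qed.

Lemma cf_filter {G S : Type} {cG : codable G} {cS : codable S}
    (s : G -> seq S) (f : G -> S -> bool) :
  computable s -> computable (fun p : G * S => f p.1 p.2) ->
  computable (fun x => [seq a <- s x | f x a]).
Proof.
move=> hs hf.
apply: (@eq_cf _ _ _ _
  (fun x => foldr (fun a l => if f x a then a :: l else l) [::] (s x))).
  apply: cf_foldr; [done | | exact: cf_const].
  have hl : computable (fun p : G * (seq S * S) => p.2.1).
    by exact: cf_fst (cf_snd cf_id).
  have hr : computable (fun p : G * (seq S * S) => p.2.2).
    by exact: cf_snd (cf_snd cf_id).
  apply: cf_if => //; last exact: cf_cons.
  apply: (cf_comp (f := fun p : G * (seq S * S) => (p.1, p.2.2)) hf).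
  by apply: cf_pair => //; exact: cf_fst cf_id.
by move=> x; elim: (s x) => //= a l ->.
Qed.

Lemma cf_size {G T : Type} {cG : codable G} {cT : codable T}
    (s : G -> seq T) : computable s -> computable (fun x => size (s x)).
Proof.
move=> hs.
apply: (@eq_cf _ _ _ _ (fun x => foldr (fun _ n => n.+1) 0 (s x))) => //.
apply: cf_foldr; [done | | exact: cf_const].
exact: cf_succ (cf_fst (cf_snd cf_id)).
Qed.

Lemma cf_count {G S : Type} {cG : codable G} {cS : codable S}
    (s : G -> seq S) (f : G -> S -> bool) :
  computable s -> computable (fun p : G * S => f p.1 p.2) ->
  computable (fun x => count (f x) (s x)).
Proof.
move=> hs hf; apply: (@eq_cf _ _ _ _ (fun x => size ([seq a <- s x | f x a]))).
  by apply: cf_size; exact: cf_filter.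
by move=> x; rewrite size_filter.
Qed.

Lemma cf_has {G S : Type} {cG : codable G} {cS : codable S}
    (s : G -> seq S) (f : G -> S -> bool) :
  computable s -> computable (fun p : G * S => f p.1 p.2) ->
  computable (fun x => has (f x) (s x)).
Proof.
move=> hs hf; apply: (@eq_cf _ _ _ _ (fun x => 0 < count (f x) (s x))).
  by apply: cf_leq; [exact: cf_const | exact: cf_count].
by move=> x; rewrite has_count.
Qed.

Lemma cf_all {G S : Type} {cG : codable G} {cS : codable S}
    (s : G -> seq S) (f : G -> S -> bool) :
  computable s -> computable (fun p : G * S => f p.1 p.2) ->
  computable (fun x => all (f x) (s x)).
Proof.
move=> hs hf; apply: (@eq_cf _ _ _ _ (fun x => ~~ has (fun a => ~~ f x a) (s x))).
  by apply: cf_neg; apply: cf_has => //; exact: cf_neg.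
by move=> x; rewrite -all_predC; apply: eq_all => a /=; rewrite negbK.
Qed.

Lemma cf_flatten {G T : Type} {cG : codable G} {cT : codable T}
    (s : G -> seq (seq T)) :
  computable s -> computable (fun x => flatten (s x)).
Proof.
move=> hs; apply: cf_foldr; [done | | exact: cf_const].
by apply: cf_cat; [exact: cf_snd (cf_snd cf_id) | exact: cf_fst (cf_snd cf_id)].
Qed.

Lemma cf_iota0 {G : Type} {cG : codable G}
    (n : G -> nat) : computable n -> computable (fun x => iota 0 (n x)).
Proof.
move=> hn.
apply: (@eq_cf _ _ _ _ (fun x => iteri (n x) (fun k l => l ++ [:: k]) [::])).
  apply: cf_iteri; [done | | exact: cf_const].
  apply: cf_cat; first exact: cf_snd (cf_snd cf_id).
  by apply: cf_cons; [exact: cf_fst (cf_snd cf_id) | exact: cf_const].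
by move=> x; elim: (n x) => [//|k IH]; rewrite -[in RHS]addn1 iotaD -IH.
Qed.

Lemma cf_mem {G : Type} {cG : codable G}
    (U : eqType) (cU : codable U) (f : G -> U) (s : G -> seq U) :
  computable f -> computable s -> computable (fun x => f x \in s x).
Proof.
move=> hf hs; apply: (@eq_cf _ _ _ _ (fun x => has (fun a => a == f x) (s x))).
  apply: cf_has => //; apply: cf_eq; first exact: cf_snd cf_id.
  exact: cf_comp hf (cf_fst cf_id).
by move=> x; rewrite has_pred1.
Qed.

Lemma cf_nth {G T : Type} {cG : codable G} {cT : codable T}
    (x0 : T) (n : G -> nat) (s : G -> seq T) :
  computable n -> computable s -> computable (fun x => nth x0 (s x) (n x)).
Proof.
move=> hn hs.
have h : computable (fun x => head dflt (iter (n x) behead (s x))).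
  by apply: cf_head; apply: cf_iter => //; apply: cf_behead; exact: cf_snd cf_id.
have h' : computable (fun x => if n x < size (s x)
    then head dflt (iter (n x) behead (s x)) else x0).
  apply: cf_if => //; last exact: cf_const.
  by apply: cf_leq; [exact: cf_succ | exact: cf_size].
apply: eq_cf h' _ => x; case: ltnP => [lt|ge]; last by rewrite nth_default.
rewrite -nth0 (_ : iter _ _ _ = drop (n x) (s x)) ?nth_drop ?addn0; last first.
  by elim: (n x) => [|k IH] /=; rewrite ?drop0// IH -drop1 drop_drop add1n.
exact: set_nth_default.
Qed.

Create HintDb computable discriminated.
#[global] Hint Constants Opaque : computable.
#[global] Hint Transparent bitseq : computable.
#[global] Hint Resolve cf_id cf_const cf_pair cf_fst cf_snd cf_iteri cf_succ cf_if
  cf_pred cf_iter cf_add cf_sub cf_mul cf_exp cf_leq cf_and cf_or cf_neg cf_eq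
  cf_cpair cf_cons cf_behead cf_head cf_foldl cf_rev cf_foldr cf_cat cf_map
  cf_filter cf_size cf_count cf_has cf_all cf_flatten cf_iota0 cf_mem cf_nth : computable.

(** A codomain may appear as the sort of an [eqType], which hides the type that the hints speak
    of. *)
Ltac unfold_codomain :=
  match goal with
  | |- @computable ?S (Equality.sort ?E) ?cS ?cT ?f =>
      let t := eval hnf in (Equality.sort E) in change (@computable S t cS cT f)
  end.
#[global] Hint Extern 0 (computable _) => unfold_codomain : computable.

Ltac cf_auto := solve [eauto 2000 with computable nocore].

Lemma cf_nat_of_bool {G} {cG : codable G} (b : G -> bool) :
  computable b -> computable (fun x => nat_of_bool (b x)).
Proof. by []. Qed.

Lemma cf_double {G} {cG : codable G} (f : G -> nat) :
  computable f -> computable (fun x => (f x).*2).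
Proof.
move=> hf; have h : computable (fun x => f x + f x) by cf_auto.
by apply: eq_cf h _ => x; rewrite addnn.
Qed.

Lemma cf_nseq {G T} {cG : codable G} {cT : codable T} (n : G -> nat) (f : G -> T) :
  computable n -> computable f -> computable (fun x => nseq (n x) (f x)).
Proof.
move=> hn hf.
have h : computable (fun x => [seq f x | _ <- iota 0 (n x)]).
  apply: cf_map; first cf_auto.
  by apply: cf_comp; [exact: hf | cf_auto].
apply: eq_cf h _ => x; rewrite -[n x in RHS](size_iota 0).
by elim: (iota _ _) => //= a l ->.
Qed.

Lemma cf_rcons {G T : Type} {cG : codable G} {cT : codable T}
    (s : G -> seq T) (a : G -> T) :
  computable s -> computable a -> computable (fun x => rcons (s x) (a x)).
Proof.
move=> hs ha; have h : computable (fun x => s x ++ [:: a x]) by cf_auto.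
by apply: eq_cf h _ => x; rewrite cats1.
Qed.

Lemma cf_sumn {G : Type} {cG : codable G} (s : G -> seq nat) :
  computable s -> computable (fun x => sumn (s x)).
Proof. by move=> hs; apply: cf_foldr; cf_auto. Qed.

#[global] Hint Resolve cf_nat_of_bool cf_double cf_nseq cf_rcons cf_sumn : computable.

Lemma cf_str_num {G} {cG : codable G} (f : G -> seq bool) :
  computable f -> computable (fun x => str_num (f x)).
Proof. by move=> hf; apply: cf_foldl; cf_auto. Qed.

(** The logarithm of [n] is the number of [k < n] with [p ^ k.+1 <= n]. *)
Lemma cf_trunc_log {G} {cG : codable G} (p : nat) (f : G -> nat) :
  1 < p -> computable f -> computable (fun x => trunc_log p (f x)).
Proof.
move=> hp hf.
have h : computable (fun x => count (fun k => p ^ k.+1 <= f x) (iota 0 (f x))).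
  have hf2 : computable (fun q : G * nat => f q.1).
    by apply: cf_comp; [exact: hf | cf_auto].
  cf_auto.
apply: eq_cf h _ => x; move: (f x) => n.
have [->|n0] := posnP n; first by rewrite trunc_log0.
have [h1 h2] := andP (trunc_log_bounds hp n0); set t := trunc_log p n in h1 h2 *.
have tn : t <= n by apply: leq_trans h1; apply/ltnW/ltn_expl.
rewrite -(subnKC tn) iotaD count_cat add0n.
rewrite (@eq_in_count _ _ predT) ?count_predT ?size_iota; last first.
  move=> k; rewrite mem_iota subnKC// => /andP[_ lt]; apply/idP.
  by apply: leq_trans h1; rewrite leq_exp2l.
rewrite (@eq_in_count _ _ pred0) ?count_pred0 ?addn0// => k.
rewrite mem_iota subnKC// => /andP[le _]; apply/negP/negP; rewrite -ltnNge.
by apply: leq_trans h2 _; rewrite leq_exp2l// ltnS.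
Qed.

#[global] Hint Resolve cf_str_num cf_trunc_log : computable.
#[global] Hint Extern 1 (is_true (1 < 2)) => exact isT : computable.

(** * Unbounded search *)

Lemma cf_search {S} {cS : codable S} (D : S -> nat -> bool) :
  computable (fun p : S * nat => D p.1 p.2) ->
  exists e, forall A x k,
    oracle_eval A e (enc x) k <-> D x k /\ forall j, j < k -> ~~ D x j.
Proof.
(* [Mu] looks for the value [0], so the test is negated. *)
move=> hD; have [e he] : computable (fun p : S * nat => ~~ D p.1 p.2) by cf_auto.
have hE A x k v : oracle_eval A e (cpair (enc x) k) v <-> v = ~~ D x k.
  split=> [h|->]; first exact: oracle_eval_fun h (he A (x, k)).
  exact: (he A (x, k)).
exists (Mu e) => A x k /=; split.
- move=> [/hE h0 h]; split; first by move: h0; case: (D x k).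
  by move=> j /h [m /hE]; case: (D x j).
- move=> [h0 h]; split; first by apply/hE; rewrite h0.
  by move=> j /h hj; exists 0; apply/hE; rewrite hj.
Qed.

Lemma ex_least (P : pred nat) : (exists k, P k) ->
  exists k, P k /\ forall j, j < k -> ~~ P j.
Proof.
move=> h; have [k hk mk] := ex_minnP h; exists k; split=> // j lt.
by apply/negP => /mk; rewrite leqNgt lt.
Qed.

Lemma comp_enum_search (D : nat -> nat -> bool) :
  computable (fun p : nat * nat => D p.1 p.2) ->
  comp_enum [set x | exists k, D x k]%classic.
Proof.
move=> /cf_search[e he]; exists e; apply/seteqP; split => x /=.
- by move=> /ex_least[k hk]; exists k; apply/(he _ x).
- by move=> [k /(he _ x)[hk _]]; exists k.
Qed.

(** Turns an enumeration of outputs by stages into a program. The compressing machine arises in this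
    way, since its outputs appear only after a number has entered the halting problem. *)
Lemma first_output_machine (F : nat -> nat -> seq nat) :
  computable (fun p : nat * nat => F p.1 p.2) ->
  exists M, forall A x y, oracle_eval A M x y <->
    exists k, [/\ F x k != [::], forall j, j < k -> F x j = [::]
                & y = head 0 (F x k)].
Proof.
move=> hF; have hD : computable (fun p : nat * nat => F p.1 p.2 != [::]) by cf_auto.
have [e he] := cf_search (D := fun x k => F x k != [::]) hD.
have [e' he'] : computable (fun p : nat * nat => head 0 (F p.1 p.2)).
  by apply: (cf_head (T := nat)).
exists (Comp e' (Pair (Pair Left Right) e)) => A x y /=.
have hp u : (exists u0 v, [/\ exists b, x = cpair u0 b, exists a, x = cpair a v
    & u = cpair u0 v]) <-> u = x.
  split=> [[u0 [v [[b hb] [a ha] ->]]]|->].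
    by have [_ <-] := cpair_inj (etrans (esym hb) ha).
  have [a [b e0]] := cpair_surj x; exists a, b.
  by split=> //; [exists b | exists a].
split.
- move=> [_ [_ [k [/hp-> /(he A x)[hk hj] ->]]] hy].
  exists k; split=> // [j /hj/negPn/eqP//|].
  exact: oracle_eval_fun hy (he' A (x, k)).
- move=> [k [hk hj ->]]; exists (cpair x k); last exact: (he' A (x, k)).
  exists x, k; split=> //; first exact/hp.
  by apply/(he A x); split=> // j /hj->.
Qed.

(** The program will run inside a search over [k], whose own argument travels along in [a]. *)
Lemma oracle_mkseq (z : nat -> bool) :
  exists e, forall a k, oracle_eval z e (cpair a k) (enc (mkseq z k)).
Proof.
have [eb hb] : computable (fun _ : nat => ([::] : seq bool)) by cf_auto.
have [es hs] : computable (fun p : seq bool * bool => p.1 ++ [:: p.2]) by cf_auto.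
have [er hr] : computable (fun p : nat * (nat * seq bool) => p.2.2) by cf_auto.
have [ek hk] : computable (fun p : nat * (nat * seq bool) => p.2.1) by cf_auto.
exists (Prec eb (Comp es (Pair er (Comp Oracle ek)))) => a k.
exists a, k; split=> //; elim: k => [|k IH] /=; first exact: (hb z a).
exists (enc (mkseq z k)) => //.
exists (cpair (enc (mkseq z k)) (z k)).
  exists (enc (mkseq z k)), (z k); split=> //; first exact: (hr z (a, (k, mkseq z k))).
  by exists k => //; exact: (hk z (a, (k, mkseq z k))).
by have := hs z (mkseq z k, z k); rewrite /= cats1 -mkseqS.
Qed.

(** The oracle machine looks for a prefix of [z] that is a certificate for [x] and reads the answer
    off it. Since every certificate is sound, it does not matter which one is found first. *)
Lemma turing_le_search (D F : nat -> seq bool -> bool) (A z : nat -> bool) :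
  computable (fun p : nat * seq bool => D p.1 p.2) ->
  computable (fun p : nat * seq bool => F p.1 p.2) ->
  (forall x, exists k, D x (mkseq z k)) ->
  (forall x k, D x (mkseq z k) -> F x (mkseq z k) = A x) ->
  turing_le A z.
Proof.
move=> hD hF ex sound.
have [em hm] := oracle_mkseq z.
have [eD heD] : computable (fun p : nat * seq bool => ~~ D p.1 p.2) by cf_auto.
have [eF heF] := hF.
have [i0 hi0] : computable (fun x : nat => x) by cf_auto.
have [l0 hl0] : computable (fun x : nat * nat => x.1) by cf_auto.
pose tb := Pair l0 em.
have htb x k : oracle_eval z tb (cpair x k) (enc (x, mkseq z k)).
  by exists x, (enc (mkseq z k)); split=> //; exact: (hl0 z (x, k)).
exists (Comp eF (Comp tb (Pair i0 (Mu (Comp eD tb))))) => x.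
have [k [hk hj]] := ex_least (ex x).
exists (enc (x, mkseq z k)); last first.
  by rewrite -(sound _ _ hk); exact: (heF z (x, mkseq z k)).
exists (cpair x k); last exact: htb.
exists x, k; split=> //; first exact: hi0.
have hE j : oracle_eval z (Comp eD tb) (cpair x j) (~~ D x (mkseq z j)).
  by exists (enc (x, mkseq z j)); [exact: htb | exact: (heD z (x, mkseq z j))].
split; first by have := hE k; rewrite hk.
by move=> j /hj lt; exists 0; have := hE j; rewrite lt.
Qed.

(** * Evaluation in stages *)

(* [F c x y]: it is already known that the program with number [c] maps [x] to
   [y]; [O] is the graph of the oracle. *)
Inductive eval_step (O : nat -> nat -> Prop) (F : nat -> nat -> nat -> Prop) :
    nat -> nat -> nat -> Prop :=
  | Step_zero x : eval_step O F 0 x 0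
  | Step_succ x : eval_step O F 1 x x.+1
  | Step_left a b : eval_step O F 2 (cpair a b) a
  | Step_right a b : eval_step O F 3 (cpair a b) b
  | Step_oracle x y : O x y -> eval_step O F 4 x y
  | Step_pair p q x u v : F p x u -> F q x v ->
      eval_step O F (5 + 4 * cpair p q) x (cpair u v)
  | Step_comp p q x u y : F q x u -> F p u y ->
      eval_step O F (6 + 4 * cpair p q) x y
  | Step_prec0 p q a y : F p a y ->
      eval_step O F (7 + 4 * cpair p q) (cpair a 0) y
  | Step_precS p q a k r y :
      F (7 + 4 * cpair p q) (cpair a k) r -> F q (cpair a (cpair k r)) y ->
      eval_step O F (7 + 4 * cpair p q) (cpair a k.+1) y
  | Step_mu p x y : F p (cpair x y) 0 ->
      (forall k, k < y -> exists m, F p (cpair x k) m.+1) ->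
      eval_step O F (8 + 4 * p) x y.

Lemma eval_step_mono (O O' : nat -> nat -> Prop) (F F' : nat -> nat -> nat -> Prop) :
  (forall x y, O x y -> O' x y) -> (forall c x y, F c x y -> F' c x y) ->
  forall c x y, eval_step O F c x y -> eval_step O' F' c x y.
Proof.
move=> hO hF c x y; case.
- by move=> w; exact: Step_zero.
- by move=> w; exact: Step_succ.
- by move=> a b; exact: Step_left.
- by move=> a b; exact: Step_right.
- by move=> w v /hO; exact: Step_oracle.
- by move=> p q w u v /hF h /hF h'; exact: Step_pair h h'.
- by move=> p q w u v /hF h /hF h'; exact: Step_comp h h'.
- by move=> p q a v /hF; exact: Step_prec0.
- by move=> p q a k r v /hF h /hF h'; exact: Step_precS h h'.
- move=> p w v /hF h0 h; apply: Step_mu => // k /h[m /hF hm].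
  by exists m.
Qed.

Definition fact : Type := nat * (nat * nat).

(** The searches for subprograms and for components of the input stay below [c.+1] and [x.+1],
    because [cpair] bounds both of its arguments. *)
Definition eval_stepb (tau : bitseq) (F : seq fact) (c x y : nat) : bool :=
  [|| (c == 0) && (y == 0), (c == 1) && (y == x.+1),
      (c == 2) && has (fun b => x == cpair y b) (iota 0 x.+1),
      (c == 3) && has (fun a => x == cpair a y) (iota 0 x.+1),
      [&& c == 4, x < size tau & y == nth false tau x],
      has (fun p => has (fun q =>
        [|| (c == 5 + 4 * cpair p q) &&
            has (fun g => has (fun g' =>
              [&& g.1 == p, g.2.1 == x, g'.1 == q, g'.2.1 == x
                & y == cpair g.2.2 g'.2.2]) F) F,
            (c == 6 + 4 * cpair p q) &&
            has (fun g => [&& g.1 == q, g.2.1 == x & (p, (g.2.2, y)) \in F]) F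
          | (c == 7 + 4 * cpair p q) &&
            has (fun a => (x == cpair a 0) && ((p, (a, y)) \in F) ||
              has (fun k => (x == cpair a k.+1) &&
                has (fun g => [&& g.1 == c, g.2.1 == cpair a k
                  & (q, (cpair a (cpair k g.2.2), y)) \in F]) F)
                (iota 0 x.+1))
              (iota 0 x.+1)])
        (iota 0 c)) (iota 0 c)
    | has (fun p => [&& c == 8 + 4 * p, (p, (cpair x y, 0)) \in F
        & all (fun k => has (fun g =>
              [&& g.1 == p, g.2.1 == cpair x k & 0 < g.2.2]) F) (iota 0 y)])
        (iota 0 c)].

Definition prefix_oracle (tau : bitseq) (x y : nat) : Prop :=
  x < size tau /\ y = nth false tau x.

Lemma eval_stepP (tau : bitseq) (F : seq fact) (c x y : nat) :
  reflect (eval_step (prefix_oracle tau)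
             (fun c x y => (c, (x, y)) \in F) c x y)
          (eval_stepb tau F c x y).
Proof.
apply: (iffP idP).
- case/or4P.
  + by case/andP => /eqP-> /eqP->; constructor.
  + by case/andP => /eqP-> /eqP->; constructor.
  + by case/andP => /eqP-> /hasP[b _ /eqP->]; constructor.
  case/or4P.
  + by case/andP => /eqP-> /hasP[b _ /eqP->]; constructor.
  + by case/and3P => /eqP-> lt /eqP->; constructor.
  + case/hasP => p _ /hasP[q _] /or3P[] /andP[/eqP->].
    * case/hasP => -[? [? u]] hg /hasP[[? [? v]] hg'] /=.
      case/and5P => /eqP ? /eqP ? /eqP ? /eqP ? /eqP ->; subst.
      by constructor.
    * case/hasP => -[? [? u]] hg /= /and3P[/eqP ? /eqP ? h]; subst.
      exact: Step_comp hg h.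
    * case/hasP => a _ /orP[/andP[/eqP-> h]|]; first by constructor.
      case/hasP => k _ /andP[/eqP->] /hasP[[? [? r]] hg] /=.
      by case/and3P => /eqP ? /eqP ? h; subst; exact: Step_precS hg h.
  + case/hasP => p _ /and3P[/eqP-> h0 /allP h]; constructor=> // k lt.
    have /h/hasP[[? [? [|m]]] hg] : k \in iota 0 y by rewrite mem_iota.
      by rewrite /= !andbF.
    by case/and3P => /= /eqP ? /eqP ? _; subst; exists m.
- have mem_i a n : a < n -> a \in iota 0 n by rewrite mem_iota.
  have in1 a b n : a \in iota 0 (n.+1 + 4 * cpair a b).
    by apply: mem_i; have := leq_cpairl a b; lia.
  have in2 a b n : b \in iota 0 (n.+1 + 4 * cpair a b).
    by apply: mem_i; have := leq_cpairr a b; lia.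
  case=> //= {c x y}.
  + by move=> x; rewrite /eval_stepb /= eqxx.
  + move=> a b; apply/or4P; apply: Or43.
    by apply/hasP; exists b; rewrite ?mem_i ?ltnS ?leq_cpairr.
  + move=> a b; apply/or4P; apply: Or44; apply/orP; left.
    by apply/hasP; exists a; rewrite ?mem_i ?ltnS ?leq_cpairl.
  + by move=> x y [lt ->]; rewrite /eval_stepb /= lt eqxx.
  + move=> p q x u v hp hq; apply/or4P; apply: Or44; apply/or4P; apply: Or43.
    apply/hasP; exists p; first exact: in1.
    apply/hasP; exists q; first exact: in2.
    apply/or3P; apply: Or31; rewrite eqxx andTb.
    apply/hasP; exists (p, (x, u)) => //; apply/hasP; exists (q, (x, v)) => //=.
    by rewrite !eqxx.
  + move=> p q x u y hq hp; apply/or4P; apply: Or44; apply/or4P; apply: Or43.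
    apply/hasP; exists p; first exact: in1.
    apply/hasP; exists q; first exact: in2.
    apply/or3P; apply: Or32; rewrite eqxx andTb.
    by apply/hasP; exists (q, (x, u)) => //=; rewrite !eqxx.
  + move=> p q a y h; apply/or4P; apply: Or44; apply/or4P; apply: Or43.
    apply/hasP; exists p; first exact: in1.
    apply/hasP; exists q; first exact: in2.
    apply/or3P; apply: Or33; rewrite eqxx andTb.
    by apply/hasP; exists a; rewrite ?mem_i ?ltnS ?leq_cpairl// eqxx h.
  + move=> p q a k r y h h'; apply/or4P; apply: Or44; apply/or4P; apply: Or43.
    apply/hasP; exists p; first exact: in1.
    apply/hasP; exists q; first exact: in2.
    apply/or3P; apply: Or33; rewrite eqxx andTb.
    apply/hasP; exists a; rewrite ?mem_i ?ltnS ?leq_cpairl//; apply/orP; right.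
    apply/hasP; exists k.
      by rewrite mem_i// ltnS; apply: leq_trans (leq_cpairr a k.+1).
    rewrite eqxx andTb; apply/hasP; exists (7 + 4 * cpair p q, (cpair a k, r)) => //=.
    by rewrite !eqxx.
  + move=> p x y h0 h; apply/or4P; apply: Or44; apply/or4P; apply: Or44.
    apply/hasP; exists p; first by rewrite mem_i//; lia.
    rewrite eqxx h0 !andTb; apply/allP => k; rewrite mem_iota => /h[m hm].
    by apply/hasP; exists (p, (cpair x k, m.+1)) => //=; rewrite !eqxx.
Qed.

Definition candidates (b : nat) : seq fact :=
  flatten [seq flatten [seq [seq (c, (x, y)) | y <- iota 0 b] | x <- iota 0 b]
          | c <- iota 0 b].

Lemma mem_candidates (b c x y : nat) :
  ((c, (x, y)) \in candidates b) = [&& c < b, x < b & y < b].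
Proof.
apply/flatten_mapP/and3P.
- move=> [c' hc /flatten_mapP[x' hx /mapP[y' hy [-> -> ->]]]].
  by move: hc hx hy; rewrite !mem_iota.
- move=> [hc hx hy]; exists c; rewrite ?mem_iota//.
  apply/flatten_mapP; exists x; rewrite ?mem_iota//.
  by apply/mapP; exists y; rewrite ?mem_iota.
Qed.

Definition facts (tau : bitseq) (k : nat) : seq fact :=
  iter k (fun F =>
    [seq f <- candidates (size tau) | eval_stepb tau F f.1 f.2.1 f.2.2]) [::].

Lemma factsS (tau : bitseq) (k : nat) : facts tau k.+1 =
  [seq f <- candidates (size tau) | eval_stepb tau (facts tau k) f.1 f.2.1 f.2.2].
Proof. by []. Qed.

Lemma facts_mono (tau tau' : bitseq) (k k' : nat) :
  prefix tau tau' -> k <= k' -> {subset facts tau k <= facts tau' k'}.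
Proof.
move=> pre; elim: k k' => [|k IH] [|k']//= /IH sub [c [x y]].
rewrite !mem_filter !mem_candidates => /andP[/eval_stepP h /and3P[h1 h2 h3]].
have le : size tau <= size tau' by exact: size_prefix.
apply/andP; split; last by apply/and3P; split; exact: leq_trans le.
apply/eval_stepP; apply: eval_step_mono h => [u v [lt ->]|u v w /sub//].
split; first exact: leq_trans le.
by move: pre => /prefixP[s ->]; rewrite nth_cat lt.
Qed.

(** The length of [tau] limits the oracle queries, the size of the numbers and the number of rounds
    at once, so a longer prefix also means a longer run. *)
Definition evals (tau : bitseq) (c x y : nat) : bool :=
  (c, (x, y)) \in facts tau (size tau).

Lemma evals_mono (tau tau' : bitseq) (c x y : nat) :
  prefix tau tau' -> evals tau c x y -> evals tau' c x y.
Proof. by move=> pre; apply: facts_mono => //; exact: size_prefix. Qed.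

Lemma evals_bound (tau : bitseq) (c x y : nat) :
  evals tau c x y -> [/\ c < size tau, x < size tau & y < size tau].
Proof.
rewrite /evals; case: {1}(size tau) => [|k] //=.
by rewrite mem_filter => /andP[_]; rewrite mem_candidates => /and3P.
Qed.

Lemma evals_sound (A : nat -> bool) (t : nat) (e : prog) (x y : nat) :
  evals (mkseq A t) (prog_num e) x y -> oracle_eval A e x y.
Proof.
rewrite /evals; move: (size _) => k; elim: k e x y => [|k IH] e x y //=.
rewrite mem_filter => /andP[/eval_stepP h _]; move: h.
(* The number of the program is generalized to [c] so that the rules can be inverted; the equation
   then forces the constructor of [e]. *)
have key c : eval_step (prefix_oracle (mkseq A t))
    (fun c x y => (c, (x, y)) \in facts (mkseq A t) k) c x y ->
    prog_num e = c -> oracle_eval A e x y.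
  case=> {c x y}.
  - by move=> x; case: e.
  - by move=> x; case: e.
  - by move=> a b; case: e => //= _; exists b.
  - by move=> a b; case: e => //= _; exists a.
  - move=> x y [+ ->]; rewrite size_mkseq => lt; case: e => //= _.
    by rewrite nth_mkseq.
  - move=> p q x u v; case: e => //=; try by move=> *; lia.
    + move=> f g hp hq h.
      have /cpair_inj[ep eq] : cpair (prog_num f) (prog_num g) = cpair p q by lia.
      by exists u, v; split=> //; apply: IH; rewrite ?ep ?eq.
  - move=> p q x u v; case: e => //=; try by move=> *; lia.
    + move=> f g hq hp h.
      have /cpair_inj[ep eq] : cpair (prog_num f) (prog_num g) = cpair p q by lia.
      by exists u; apply: IH; rewrite ?ep ?eq.
  - move=> p q a y; case: e => //=; try by move=> *; lia.
    + move=> f g hp h.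
      have /cpair_inj[ep eq] : cpair (prog_num f) (prog_num g) = cpair p q by lia.
      by exists a, 0; split=> //=; apply: IH; rewrite ep.
  - move=> p q a n r y; case: e => //=; try by move=> *; lia.
    + move=> f g hp hq h.
      have /cpair_inj[ep eq] : cpair (prog_num f) (prog_num g) = cpair p q by lia.
      exists a, n.+1; split=> //=.
      have [a' [n' [/cpair_inj[<- <-] h']]] : oracle_eval A (Prec f g) (cpair a n) r.
        by apply: IH; rewrite /= ep eq.
      by exists r => //; apply: IH; rewrite eq.
  - move=> p x y; case: e => //=; try by move=> *; lia.
    + move=> f h0 hk h; have ep : prog_num f = p by lia.
      split; first by apply: IH; rewrite ep.
      by move=> j /hk[m hm]; exists m; apply: IH; rewrite ep.
by move=> h; exact: key h erefl.
Qed.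

(** From [5] on, the residue of [c - 5] modulo [4] names the constructor and the quotient codes its
    arguments. *)
Lemma prog_num_surj (c : nat) : exists e, prog_num e = c.
Proof.
elim/ltn_ind: c => c IH.
case: (ltnP c 5) => [|c5].
  case: c {IH} => [|[|[|[|[|//]]]]] _;
    [exists Zero | exists Succ | exists Left | exists Right | exists Oracle]; done.
have [p [q e]] := cpair_surj ((c - 5) %/ 4).
have hp := leq_cpairl p q; have hq := leq_cpairr p q.
have [f hf] : exists e, prog_num e = p by apply: IH; lia.
have [g hg] : exists e, prog_num e = q by apply: IH; lia.
have : (c - 5) %% 4 < 4 by rewrite ltn_mod.
have := divn_eq (c - 5) 4; rewrite e.
case: (_ %% 4) => [|[|[|[|//]]]] h _.
- by exists (Pair f g); rewrite /= hf hg; lia.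
- by exists (Comp f g); rewrite /= hf hg; lia.
- by exists (Prec f g); rewrite /= hf hg; lia.
- have [f' hf'] : exists e, prog_num e = cpair p q by apply: IH; lia.
  by exists (Mu f'); rewrite /= hf'; lia.
Qed.

Lemma prefix_mkseq (A : nat -> bool) (t t' : nat) :
  t <= t' -> prefix (mkseq A t) (mkseq A t').
Proof.
move=> le; apply/prefixP; exists (map A (iota t (t' - t))).
by rewrite /mkseq -map_cat -iotaD subnKC.
Qed.

Lemma evals_mkseq_mono (A : nat -> bool) (t t' c x y : nat) :
  t <= t' -> evals (mkseq A t) c x y -> evals (mkseq A t') c x y.
Proof. by move=> /prefix_mkseq/evals_mono; apply. Qed.

Lemma evals_step (A : nat -> bool) (t c x y : nat) :
  eval_step (fun x y => y = A x) (fun c x y => evals (mkseq A t) c x y) c x y ->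
  exists t', evals (mkseq A t') c x y.
Proof.
(* [t'] exceeds all three numbers, which makes them candidates, and allows one round more than
   [m >= t], by which all facts known from the prefix of length [t] are present. *)
move=> h; pose m := maxn t (maxn c (maxn x y)); pose t' := m.+1; exists t'.
have [tt' ct xt yt] : [/\ t <= t', c < t', x < t' & y < t'] by split; lia.
rewrite /evals size_mkseq factsS mem_filter size_mkseq.
rewrite mem_candidates ct xt yt !andbT; apply/eval_stepP.
have ob u (v : nat) : v = A u -> u < t' -> v = nth false (mkseq A t') u.
  by move=> -> lt; rewrite nth_mkseq.
have sub c' x' y' : evals (mkseq A t) c' x' y' ->
    (c', (x', y')) \in facts (mkseq A t') m.
  by apply: facts_mono; [exact: prefix_mkseq | rewrite size_mkseq; lia].
have : eval_step (fun x y => y = A x /\ x < t')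
    (fun c x y => evals (mkseq A t) c x y) c x y.
  by case: h xt; try by [constructor]; move=> *; econstructor; eauto.
apply: eval_step_mono => [u v [e lt]|]; last exact: sub.
by rewrite /prefix_oracle size_mkseq; split=> //; exact: ob.
Qed.

Lemma evals_complete (A : nat -> bool) (e : prog) (x y : nat) :
  oracle_eval A e x y -> exists t, evals (mkseq A t) (prog_num e) x y.
Proof.
have common (t t' : nat) c u v c' u' v' :
    evals (mkseq A t) c u v -> evals (mkseq A t') c' u' v' ->
    exists s, evals (mkseq A s) c u v /\ evals (mkseq A s) c' u' v'.
  move=> h h'; exists (maxn t t').
  by split; [move: h | move: h']; apply: evals_mkseq_mono; lia.
elim: e x y => [||||| f IHf g IHg | f IHf g IHg | f IHf g IHg | f IHf] x y.
- by move=> /= ->; apply: (@evals_step _ 0); exact: Step_zero.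
- by move=> /= ->; apply: (@evals_step _ 0); exact: Step_succ.
- by move=> [b ->]; apply: (@evals_step _ 0); exact: Step_left.
- by move=> [a ->]; apply: (@evals_step _ 0); exact: Step_right.
- by move=> /= ->; apply: (@evals_step _ 0); exact: Step_oracle.
- move=> [u [v [/IHf[t h] /IHg[t' h'] ->]]].
  have [s [hs hs']] := common _ _ _ _ _ _ _ _ h h'.
  by apply: (@evals_step _ s); exact: Step_pair hs hs'.
- move=> [u /IHg[t h] /IHf[t' h']].
  have [s [hs hs']] := common _ _ _ _ _ _ _ _ h h'.
  by apply: (@evals_step _ s); exact: Step_comp hs hs'.
- move=> [a [n [-> h]]]; elim: n y h => [|n IHn] y /=.
    by move=> /IHf[t h]; apply: (@evals_step _ t); exact: Step_prec0.
  move=> [r /IHn[t h] /IHg[t' h']].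
  have [s [hs hs']] := common _ _ _ _ _ _ _ _ h h'.
  by apply: (@evals_step _ s); exact: Step_precS hs hs'.
- move=> [/IHf[t h] hk].
  (* The finitely many evaluations below [y] have a common sufficient prefix. *)
  have [s hs] : exists s, forall k, k < y -> exists m,
      evals (mkseq A s) (prog_num f) (cpair x k) m.+1.
    elim: y {h} hk => [|y IHy] hk; first by exists 0.
    have [s hs] := IHy (fun k lt => hk k (leqW lt)).
    have [m /IHf[s' hs']] := hk y (leqnn _).
    exists (maxn s s') => k; rewrite ltnS leq_eqVlt => /predU1P[->|/hs[m' hm']].
      by exists m; apply: evals_mkseq_mono hs'; lia.
    by exists m'; apply: evals_mkseq_mono hm'; lia.
  apply: (@evals_step _ (maxn s t)); apply: Step_mu.
    by apply: evals_mkseq_mono h; lia.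
  by move=> k /hs[m hm]; exists m; apply: evals_mkseq_mono hm; lia.
Qed.

Lemma evals_fun (tau : bitseq) (c x y y' : nat) :
  evals tau c x y -> evals tau c x y' -> y = y'.
Proof.
have [e <-] := prog_num_surj c.
rewrite -[tau](mkseq_nth false) => /evals_sound h /evals_sound h'.
exact: oracle_eval_fun h h'.
Qed.

Lemma cf_evals {G} {cG : codable G} (tau : G -> bitseq) (c x y : G -> nat) :
  computable tau -> computable c -> computable x -> computable y ->
  computable (fun g => evals (tau g) (c g) (x g) (y g)).
Proof.
move=> htau hc hx hy.
have hcand : computable (fun b => candidates b).
  by apply: cf_flatten; apply: cf_map; cf_auto.
have hstep : computable (fun p : (bitseq * seq fact) * (nat * (nat * nat)) =>
    eval_stepb p.1.1 p.1.2 p.2.1 p.2.2.1 p.2.2.2).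
  by rewrite /eval_stepb; cf_auto.
have hfacts : computable (fun p : bitseq * nat => facts p.1 p.2).
  apply: cf_iter; [cf_auto | | cf_auto].
  apply: cf_filter; first by apply: cf_comp; [exact: hcand | cf_auto].
  apply: (cf_comp (f := fun p : bitseq * nat * seq fact * fact =>
    ((p.1.1.1, p.1.2), (p.2.1, (p.2.2.1, p.2.2.2)))) hstep).
  cf_auto.
apply: cf_mem; first cf_auto.
apply: (cf_comp (f := fun g => (tau g, size (tau g))) hfacts).
cf_auto.
Qed.

#[global] Hint Resolve cf_evals : computable.

(** * Stages of the halting problem *)

(** The condition [i < s] bounds the numbers that have entered by stage [s], so that they can be
    listed. *)
Definition halt_stage (i s : nat) : bool :=
  (i < s) && has (fun y => evals (nseq s false) i i y) (iota 0 s).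

Lemma cf_halt_stage {G} {cG : codable G} (i s : G -> nat) :
  computable i -> computable s -> computable (fun g => halt_stage (i g) (s g)).
Proof.
move=> hi hs.
have hf : computable (fun p : (nat * nat) => halt_stage p.1 p.2).
  by rewrite /halt_stage; cf_auto.
by apply: (cf_comp (f := fun g => (i g, s g)) hf); cf_auto.
Qed.

#[global] Hint Resolve cf_halt_stage : computable.

Lemma mkseq_no_oracle (s : nat) : mkseq no_oracle s = nseq s false.
Proof.
apply: (@eq_from_nth _ false); rewrite size_mkseq ?size_nseq// => k lt.
by rewrite nth_mkseq// nth_nseq lt.
Qed.

Lemma halt_stage_lt (i s : nat) : halt_stage i s -> i < s.
Proof. by case/andP. Qed.

Lemma halt_stage_mono (i s s' : nat) :
  s <= s' -> halt_stage i s -> halt_stage i s'.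
Proof.
move=> le /andP[lt /hasP[y]]; rewrite mem_iota => hy h.
rewrite /halt_stage (leq_trans lt le)/=; apply/hasP; exists y.
  by rewrite mem_iota; lia.
by move: h; rewrite -!mkseq_no_oracle; exact: evals_mkseq_mono.
Qed.

Lemma halting_problemP (i : nat) :
  halting_problem i <-> exists s, halt_stage i s.
Proof.
split.
- move=> [e [y /evals_complete[t h]] ei]; rewrite ei in h.
  have [_ _ lt] := evals_bound h; rewrite size_mkseq in lt.
  exists (maxn t i.+1); rewrite /halt_stage leq_maxr/=; apply/hasP; exists y.
    by rewrite mem_iota; lia.
  by rewrite -mkseq_no_oracle; apply: evals_mkseq_mono h; lia.
- move=> [s /andP[_ /hasP[y _]]]; rewrite -mkseq_no_oracle.
  have [e he] := prog_num_surj i; rewrite -he => /evals_sound h.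
  by exists e => //; exists y.
Qed.

(** * Greedy selection of strings *)

Definition words (n : nat) : seq bitseq :=
  iter n (fun l => [seq rcons s false | s <- l] ++ [seq rcons s true | s <- l])
    [:: [::]].

Lemma wordsS (n : nat) : words n.+1 =
  [seq rcons s false | s <- words n] ++ [seq rcons s true | s <- words n].
Proof. by []. Qed.

Lemma mem_words (n : nat) (s : bitseq) : (s \in words n) = (size s == n).
Proof.
elim: n s => [|n IH] s; first by rewrite inE size_eq0.
rewrite wordsS mem_cat; case/lastP: s => [|s b].
  by apply/orP => -[] /mapP[[|c s] _].
have inj c : injective (rcons^~ c : bitseq -> bitseq) by exact: rcons_injl.
have no c d : c != d -> rcons s c \notin [seq rcons x d | x <- words n].
  by move=> cd; apply/mapP => -[x _ /rcons_inj[_ /eqP]]; rewrite (negbTE cd).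
rewrite size_rcons eqSS -IH; case: b.
- by rewrite (negbTE (no true false isT)) (mem_map (inj true)).
- by rewrite (negbTE (no false true isT)) (mem_map (inj false)) orbF.
Qed.

Lemma uniq_words (n : nat) : uniq (words n).
Proof.
elim: n => // n IH; rewrite wordsS cat_uniq.
rewrite !map_inj_uniq ?IH/= ?andbT; try exact: rcons_injl.
by apply/hasPn => _ /mapP[s _ ->]; apply/mapP => -[x _ /rcons_inj[]].
Qed.

Lemma size_words (n : nat) : size (words n) = 2 ^ n.
Proof.
by elim: n => // n IH; rewrite wordsS size_cat !size_map IH expnS mul2n addnn.
Qed.

Lemma size_uniq_words (n : nat) (l : seq bitseq) :
  uniq l -> {subset l <= words n} -> size l <= 2 ^ n.
Proof. by move=> ul sub; rewrite -(size_words n); exact: uniq_leq_size. Qed.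

Lemma count_mem_words (n : nat) (l : seq bitseq) :
  uniq l -> {subset l <= words n} -> count (mem l) (words n) = size l.
Proof.
move=> ul sub; rewrite -size_filter; apply/perm_size/uniq_perm => //.
  by rewrite filter_uniq ?uniq_words.
move=> s; rewrite mem_filter /=; case hs : (s \in l) => //=.
exact: sub.
Qed.

(** In terms of measure: if a property passes to extensions, its proportion among the words of
    length [t] does not decrease with [t]. *)
Lemma leq_count_wordsS (t : nat) (P : pred bitseq) :
  (forall s b, P s -> P (rcons s b)) ->
  2 * count P (words t) <= count P (words t.+1).
Proof.
move=> hP; rewrite wordsS count_cat !count_map mul2n -addnn.
by apply: leq_add; apply: sub_count => s; exact: hP.
Qed.

Lemma sum_telescope_bound (f : nat -> nat) (C a b : nat) :
  0 < a -> (forall m, a <= m < b -> f m * (m * m.+1) <= C) ->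
  (\sum_(a <= m < b) f m) * a <= C.
Proof.
move=> a0 hf; case: (leqP b a) => [le|lt]; first by rewrite big_geq.
(* [1 / (m * m.+1) = 1 / m - 1 / m.+1], with the denominators cleared. *)
suff h : (\sum_(a <= m < b) f m) * a * b <= C * (b - a).
  have b0 : 0 < b by lia.
  by rewrite -(leq_pmul2r b0) (leq_trans h)// leq_mul2l leq_subr orbT.
move: hf; have -> : b = a + (b - a) by lia.
elim: (b - a) => [|d IH] hf; first by rewrite addn0 big_geq.
have IH' : (\sum_(a <= m < a + d) f m) * a * (a + d) <= C * (a + d - a).
  by apply: IH => m h; apply: hf; lia.
have hd : f (a + d) * ((a + d) * (a + d).+1) <= C by apply: hf; lia.
rewrite addnS big_nat_recr ?leq_addr//=.
move: IH' hd; move: (\sum_(a <= m < a + d) f m) (f (a + d)) => S F IH' hd.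
have ad : 0 < a + d by lia.
rewrite -(leq_pmul2r ad).
have -> : (a + d).+1 - a = d.+1 by lia.
have -> : (S + F) * a * (a + d).+1 * (a + d) =
  S * a * (a + d) * (a + d).+1 + F * ((a + d) * (a + d).+1) * a by lia.
have -> : C * d.+1 * (a + d) = C * (a + d - a) * (a + d).+1 + C * a.
  have -> : a + d - a = d by lia.
  by lia.
by apply: leq_add; rewrite leq_mul2r ?IH' ?hd orbT.
Qed.

Section Greedy.
(** [conv tau] stands for: the oracle prefix [tau] already determines level [n] of its tree. That
    level is [lev tau]. *)
Variables (n i : nat) (conv : bitseq -> bool) (lev : bitseq -> seq bitseq).
Hypothesis conv_mono : forall tau tau', prefix tau tau' -> conv tau ->
  conv tau' /\ lev tau' = lev tau.
Hypothesis lev_uniq : forall tau, uniq (lev tau).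
Hypothesis lev_words : forall tau, {subset lev tau <= words n}.

Definition log_card (tau : bitseq) : nat := trunc_log 2 (size (lev tau)).

(* An entry [(P, (m, s))] selects [s] for levels of [2 ^ m] to [2 ^ m.+1]
   strings; [P] is the total weight of the earlier entries. *)
Definition hit (W : seq (nat * (nat * bitseq))) (tau : bitseq) : bool :=
  has (fun a => (a.2.1 == log_card tau) && (a.2.2 \in lev tau)) W.

Arguments hit : simpl never.

(* About [2 ^ m / m ^ 2] times [2 ^ (2 * i)], scaled to be an integer for
   [m <= n]; the whole space has weight [2 ^ (3 * n)]. *)
Definition weight (m : nat) : nat := 2 ^ (2 * n + m + 2 * i - 2 * trunc_log 2 m).

Definition total_weight (W : seq (nat * (nat * bitseq))) : nat :=
  sumn [seq weight a.2.1 | a <- W].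

(** Divided by [2 ^ t], this is the measure of the oracles that would be newly hit by selecting [s]
    for levels of about [2 ^ m] strings. *)
Definition load (t : nat) (W : seq (nat * (nat * bitseq))) (m : nat)
    (s : bitseq) : nat :=
  count (fun tau => [&& conv tau, log_card tau == m, ~~ hit W tau & s \in lev tau])
    (words t).

(** The test requires the newly hit measure to be at least [weight / 2 ^ (3 * n)], so no entry
    weighs more than what it hits. *)
Definition pick_step (t : nat) (W : seq (nat * (nat * bitseq))) (p : nat * bitseq) :=
  if 2 ^ t * weight p.1 <= load t W p.1 p.2 * 2 ^ (3 * n)
  then (total_weight W, p) :: W else W.

(** The exponent is chosen so that [2 ^ (2 * i + 2) / min_log = 2 ^ - i]: the left side bounds the
    sum of the waiting measures over all [m >= min_log]. *)
Definition min_log : nat := 2 ^ (3 * i + 2).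

Definition pairs : seq (nat * bitseq) :=
  flatten [seq [seq (m, s) | s <- words n]
          | m <- [seq m <- iota 0 n.+1 | min_log <= m]].

Definition picks (t : nat) : seq (nat * (nat * bitseq)) :=
  iteri t (fun t W => foldl (pick_step t) W pairs) [::].

Lemma mem_pairs (m : nat) (s : bitseq) :
  ((m, s) \in pairs) = [&& min_log <= m, m <= n & size s == n].
Proof.
apply/flatten_mapP/and3P.
- move=> [m']; rewrite mem_filter mem_iota => /andP[h1 h2] /mapP[s' hs [-> ->]].
  by split=> //; rewrite -mem_words.
- move=> [h1 h2 h3]; exists m; first by rewrite mem_filter mem_iota h1.
  by apply/mapP; exists s; rewrite ?mem_words.
Qed.

(** An invariant may depend on the length of the words; it is checked at the start, when one pair is
    tried, and when the words grow by one bit. *)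
Lemma picks_ind (P : nat -> seq (nat * (nat * bitseq)) -> Prop) :
  P 0 [::] ->
  (forall t W p, p \in pairs -> P t W -> P t (pick_step t W p)) ->
  (forall t W, P t W -> P t.+1 W) ->
  forall t, P t (picks t).
Proof.
move=> h0 hp hS; elim=> //= t IH; apply: hS.
have : {subset pairs <= pairs} by [].
elim: {-2}pairs (picks t) IH => //= p l IHl W hW sub.
apply: IHl => [|q hq]; last by apply: sub; rewrite inE hq orbT.
by apply: hp => //; apply: sub; rewrite mem_head.
Qed.

Lemma log_card_bounds (tau : bitseq) : 0 < log_card tau ->
  2 ^ log_card tau <= size (lev tau) < 2 ^ (log_card tau).+1.
Proof.
move=> h; apply: trunc_log_bounds => //; rewrite lt0n; apply/eqP => e.
by move: h; rewrite /log_card e trunc_log0.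
Qed.

Lemma log_card_le (tau : bitseq) : log_card tau <= n.
Proof.
rewrite -[n in _ <= n](@trunc_expnK 2)//; apply: leq_trunc_log.
exact: size_uniq_words.
Qed.

Lemma hit_cons (a : nat * (nat * bitseq)) (W : seq (nat * (nat * bitseq))) tau :
  hit (a :: W) tau = (a.2.1 == log_card tau) && (a.2.2 \in lev tau) || hit W tau.
Proof. by []. Qed.

(** The weight is charged to the measure of the oracles hit so far: each entry pays with oracles
    that no earlier entry hits. *)
Lemma total_weight_le (t : nat) : total_weight (picks t) <= 2 ^ (3 * n).
Proof.
have inv : total_weight (picks t) * 2 ^ t <=
    2 ^ (3 * n) * count (fun tau => conv tau && hit (picks t) tau) (words t).
  apply: (picks_ind (P := fun t W => total_weight W * 2 ^ t <=
    2 ^ (3 * n) * count (fun tau => conv tau && hit W tau) (words t))) => //.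
  - move=> {}t W [m s] _ IH; rewrite /pick_step; case: ifP => //= le.
    rewrite /total_weight /= -/(total_weight W) mulnDl addnC.
    apply: (@leq_trans (2 ^ (3 * n) *
      (count (fun tau => conv tau && hit W tau) (words t) + load t W m s))).
      by rewrite mulnDr leq_add// mulnC (leq_trans le)// mulnC.
    rewrite leq_mul2l; apply/orP; right.
    (* The oracles counted by [load] are not hit by [W], so the two sets are disjoint and their
       counts add up. *)
    rewrite -count_predUI [X in _ + X](_ : _ = 0) ?addn0; last first.
      rewrite (@eq_count _ _ pred0) ?count_pred0// => tau /=.
      by case: (hit W tau); rewrite !(andbF, andFb, andbT)//= andbF.
    apply: sub_count => tau /= /orP[/andP[-> h]|].
      by rewrite hit_cons h orbT.
    by case/and4P => -> /eqP <- _ h; rewrite hit_cons /= eqxx h.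
  - move=> {}t W IH; rewrite expnS mulnCA.
    apply: (@leq_trans (2 * (2 ^ (3 * n) *
      count (fun tau => conv tau && hit W tau) (words t)))).
      by rewrite leq_mul2l IH.
    rewrite mulnCA leq_mul2l; apply/orP; right.
    (* A converged oracle keeps its level when it is extended, and so remains hit. *)
    apply: leq_count_wordsS => s b /andP[hc hh].
    have [hc' e] := conv_mono (prefix_rcons s b) hc.
    by move: hh; rewrite hc' /hit /log_card e.
rewrite -(leq_pmul2r (expn_gt0 2 t)) (leq_trans inv)// leq_mul2l.
by rewrite -(size_words t) count_size orbT.
Qed.

Lemma picks_subS (t : nat) : {subset picks t <= picks t.+1}.
Proof.
rewrite /= => a; elim: pairs (picks t) => //= p l IHl W ha; apply: IHl.
by rewrite /pick_step; case: ifP => // _; rewrite inE ha orbT.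
Qed.

Lemma picks_sub (t t' : nat) : t <= t' -> {subset picks t <= picks t'}.
Proof.
move=> /subnKC <-; elim: (t' - t) => [|d IH] a ha; first by rewrite addn0.
by rewrite addnS; apply: picks_subS; exact: IH.
Qed.

Lemma picks_mem (t : nat) (a : nat * (nat * bitseq)) :
  a \in picks t ->
  [/\ min_log <= a.2.1, a.2.1 <= n, size a.2.2 = n
    & a.1 + weight a.2.1 <= total_weight (picks t)].
Proof.
move: a; apply: (picks_ind (P := fun t W => forall a, a \in W ->
  [/\ min_log <= a.2.1, a.2.1 <= n, size a.2.2 = n
    & a.1 + weight a.2.1 <= total_weight W])) => //.
move=> {}t W [m s]; rewrite mem_pairs => /and3P[h1 h2 /eqP h3] IH.
rewrite /pick_step; case: ifP => // _ a; rewrite inE => /predU1P[->|/IH[? ? ? le]].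
  by split=> //=; rewrite /total_weight /= addnC.
by split=> //; apply: leq_trans le _; exact: leq_addl.
Qed.

(** The invariant is strengthened by a bound on all right ends by the total weight, which is where
    the next entry starts. *)
Lemma picks_disjoint (t : nat) (a b : nat * (nat * bitseq)) :
  a \in picks t -> b \in picks t ->
  [\/ a = b, a.1 + weight a.2.1 <= b.1 | b.1 + weight b.2.1 <= a.1].
Proof.
suff : (forall a, a \in picks t -> a.1 + weight a.2.1 <= total_weight (picks t)) /\
    forall a b, a \in picks t -> b \in picks t ->
    [\/ a = b, a.1 + weight a.2.1 <= b.1 | b.1 + weight b.2.1 <= a.1].
  by case=> _; apply.
apply: (picks_ind (P := fun t W =>
  (forall a, a \in W -> a.1 + weight a.2.1 <= total_weight W) /\
  forall a b, a \in W -> b \in W ->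
    [\/ a = b, a.1 + weight a.2.1 <= b.1 | b.1 + weight b.2.1 <= a.1])) => //.
move=> {}t W p _ [IH1 IH2]; rewrite /pick_step; case: ifP => // _; split.
  move=> {}a; rewrite inE => /predU1P[->|/IH1 le] /=.
    by rewrite /total_weight /= addnC.
  by apply: leq_trans le _; exact: leq_addl.
move=> {a b}a b; rewrite !inE => /predU1P[->|ha] /predU1P[->|hb].
- exact: Or31.
- by apply: Or33; exact: IH1.
- by apply: Or32; exact: IH1.
- exact: IH2.
Qed.

Lemma load_pick_le (t : nat) W p m s : load t (pick_step t W p) m s <= load t W m s.
Proof.
rewrite /pick_step; case: ifP => // _; apply: sub_count => tau /and4P[h1 h2 h3 h4].
by rewrite h1 h2 h4 /= andbT; move: h3; rewrite hit_cons negb_or => /andP[].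
Qed.

(** If the test fails, this is its negation. If it succeeds, the new entry hits every oracle that
    was counted and the load drops to zero. *)
Lemma load_pick_lt (t : nat) W m s :
  load t (pick_step t W (m, s)) m s * 2 ^ (3 * n) < 2 ^ t * weight m.
Proof.
rewrite {1}/pick_step; case: ifP => [_|/negbT]; last by rewrite -ltnNge.
rewrite /load (@eq_count _ _ pred0) ?count_pred0 ?muln_gt0 ?expn_gt0//.
move=> tau /=; apply/negbTE/negP => /and4P[_ /eqP e + h].
by rewrite hit_cons /= -e eqxx h.
Qed.

(** The bound holds right after [(m, s)] is tried, and later selections of the same round can only
    lower the load. *)
Lemma load_picks (t m : nat) (s : bitseq) : (m, s) \in pairs ->
  load t (picks t.+1) m s * 2 ^ (3 * n) < 2 ^ t * weight m.
Proof.
have later l W : load t (foldl (pick_step t) W l) m s <= load t W m s.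
  elim: l W => //= p l IH W; exact: leq_trans (IH _) (load_pick_le _ _ _ _ _).
rewrite /=; elim: pairs (picks t) => //= p l IH W.
rewrite inE => /predU1P[<-|]; last exact: IH.
by apply: leq_ltn_trans (load_pick_lt t W m s); rewrite leq_mul2r later orbT.
Qed.

Definition waiting (W : seq (nat * (nat * bitseq))) (tau : bitseq) : bool :=
  [&& conv tau, min_log <= log_card tau & ~~ hit W tau].

(** Double counting: each waiting oracle contributes at least [2 ^ m] strings of its level, while
    each of the [2 ^ n] strings has load below [2 ^ t * weight m / 2 ^ (3 * n)]. *)
Lemma count_waiting_log (t m : nat) : min_log <= m -> m <= n ->
  count (fun tau => [&& conv tau, log_card tau == m & ~~ hit (picks t.+1) tau])
    (words t) * 2 ^ (2 * trunc_log 2 m) <= 2 ^ (t + 2 * i).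
Proof.
move=> hm mn; set W := picks t.+1; set U := count _ _.
have m0 : 0 < m by apply: leq_trans hm; rewrite expn_gt0.
set k := trunc_log 2 m.
have km : k < m by apply: leq_trans (@trunc_logP 2 m isT m0); exact: ltn_expl.
have sum_ge : U * 2 ^ m <= \sum_(s <- words n) load t W m s.
  under eq_bigr do rewrite /load -sum1_count big_mkcond.
  rewrite exchange_big /= /U -sum1_count big_distrl /= big_mkcond /=.
  apply: leq_sum => tau _; case: ifP => // /and3P[h1 h2 h3].
  rewrite h1 h2 h3 /= -big_mkcond sum1_count mul1n.
  rewrite (count_mem_words (lev_uniq tau) (@lev_words tau)) -(eqP h2).
  by have /andP[] := @log_card_bounds tau ltac:(by rewrite (eqP h2)).
have sum_le : (\sum_(s <- words n) load t W m s) * 2 ^ (3 * n) <=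
    2 ^ n * (2 ^ t * weight m).
  rewrite big_distrl /= -(size_words n) -sum1_size big_distrl /= big_seq_cond.
  rewrite [leqRHS]big_seq_cond; apply: leq_sum => s; rewrite andbT mul1n => hs.
  by apply/ltnW/load_picks; rewrite mem_pairs hm mn -mem_words.
(* As [k < m], the subtraction in [weight] is not truncated. *)
have e : weight m * 2 ^ (2 * k) = 2 ^ (2 * n + m + 2 * i).
  by rewrite /weight -expnD subnK//; lia.
have p0 : 0 < 2 ^ (m + 3 * n) by rewrite expn_gt0.
rewrite -(leq_pmul2r p0).
apply: (@leq_trans (2 ^ n * (2 ^ t * weight m) * 2 ^ (2 * k))).
  have h : U * 2 ^ m * 2 ^ (3 * n) <= 2 ^ n * (2 ^ t * weight m).
    by apply: leq_trans sum_le; rewrite leq_mul2r sum_ge orbT.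
  by rewrite expnD mulnAC mulnA leq_mul2r h orbT.
by rewrite -!mulnA e -!expnD leq_exp2l//; lia.
Qed.

Lemma count_waiting (t : nat) :
  count (waiting (picks t.+1)) (words t) * 2 ^ i <= 2 ^ t.
Proof.
set W := picks t.+1.
pose f m := count (fun tau => [&& conv tau, log_card tau == m & ~~ hit W tau]) (words t).
have ml0 : 0 < min_log by rewrite expn_gt0.
have le : count (waiting W) (words t) <= \sum_(min_log <= m < n.+1) f m.
  rewrite /f; under eq_bigr do rewrite -sum1_count big_mkcond.
  rewrite exchange_big /= -sum1_count big_mkcond /=.
  apply: leq_sum => tau _; case: ifP => // /and3P[h1 h2 h3].
  (* A waiting oracle is counted in the summand of its own [log_card]. *)
  rewrite (@big_cat_nat _ _ _ (log_card tau)) ?leqW ?log_card_le//=.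
  rewrite (@big_ltn _ _ _ (log_card tau)) ?ltnS ?log_card_le// h1 h3 eqxx /=.
  lia.
have hf : (\sum_(min_log <= m < n.+1) f m) * min_log <= 2 ^ (t + 2 * i + 2).
  apply: sum_telescope_bound => // m /andP[hm]; rewrite ltnS => mn.
  have m0 : 0 < m by apply: leq_trans hm.
  have h := count_waiting_log t hm mn.
  have /andP[_ lt] := trunc_log_bounds (isT : 1 < 2) m0.
  (* With [k] the truncated logarithm of [m], both [m] and [m.+1] are at most [2 ^ k.+1]; this loses
     a factor of at most [4], the [+ 2] in the exponent. *)
  apply: (@leq_trans (f m * (2 ^ (trunc_log 2 m).+1 * 2 ^ (trunc_log 2 m).+1))).
    by rewrite leq_mul2l leq_mul ?orbT// ltnW.
  rewrite -expnD (_ : _ + _ = 2 * trunc_log 2 m + 2); last by lia.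
  by rewrite expnD mulnA [leqRHS]expnD leq_mul2r h orbT.
have e1 : 2 ^ i * 2 ^ (2 * i + 2) = min_log.
  by rewrite /min_log -expnD; congr (2 ^ _); lia.
have e2 : 2 ^ t * 2 ^ (2 * i + 2) = 2 ^ (t + 2 * i + 2).
  by rewrite -expnD addnA.
rewrite -(leq_pmul2r (expn_gt0 2 (2 * i + 2))) -mulnA e1 e2.
by apply: leq_trans hf; rewrite leq_mul2r le orbT.
Qed.

End Greedy.

Lemma str_num_rcons (s : bitseq) (b : bool) :
  str_num (rcons s b) = (str_num s).*2 + b.+1.
Proof. by rewrite /str_num foldl_rcons. Qed.

(** The digits are [1] and [2], so parity reveals the last bit and only the empty string has number
    [0]. *)
Lemma str_num_inj : injective str_num.
Proof.
elim/last_ind => [|s b IH] t; case/lastP: t => [|t c] //; rewrite !str_num_rcons.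
- by rewrite addnS.
- by rewrite addnS.
- case: b; case: c => e; try lia.
  + by congr rcons; apply: IH; lia.
  + by congr rcons; apply: IH; lia.
Qed.

(** * Levels of the tree computed from an oracle prefix *)

(** With an oracle other than [z] the program may fail to describe a tree; what is awaited is just a
    value [0] or [1] at every string of length [n]. *)
Definition level_defined (c n : nat) (tau : bitseq) : bool :=
  all (fun s => evals tau c (str_num s) 0 || evals tau c (str_num s) 1) (words n).

Definition level_of (c n : nat) (tau : bitseq) : seq bitseq :=
  [seq s <- words n | evals tau c (str_num s) 1].

Lemma level_of_mono (c n : nat) (tau tau' : bitseq) :
  prefix tau tau' -> level_defined c n tau ->
  level_defined c n tau' /\ level_of c n tau' = level_of c n tau.
Proof.
move=> pre /allP h; split.
  apply/allP => s /h /orP[] /(evals_mono pre) ->; by rewrite ?orbT.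
apply: eq_in_filter => s /h /orP[] e; last by rewrite e (evals_mono pre e).
by apply/idP/idP => [/(evals_fun (evals_mono pre e))|/(evals_fun e)].
Qed.

Lemma level_of_uniq (c n : nat) (tau : bitseq) : uniq (level_of c n tau).
Proof. by rewrite filter_uniq ?uniq_words. Qed.

Lemma level_of_words (c n : nat) (tau : bitseq) :
  {subset level_of c n tau <= words n}.
Proof. by move=> s; rewrite mem_filter => /andP[]. Qed.

(** Once [i] has entered by stage [t], this is the first stage at which it has, whatever [t] is. *)
Definition entry_stage (i t : nat) : nat :=
  count (fun s => ~~ halt_stage i s) (iota 0 t).

Lemma entry_stageP (i t : nat) : halt_stage i t ->
  [/\ halt_stage i (entry_stage i t), entry_stage i t <= t
    & forall s, s < entry_stage i t -> ~~ halt_stage i s].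
Proof.
move=> h; have [s [hs mins]] := ex_least (ex_intro _ t h).
suff -> : entry_stage i t = s.
  by split=> //; rewrite leqNgt; apply/negP => /mins; rewrite h.
have st : s <= t by rewrite leqNgt; apply/negP => /mins; rewrite h.
rewrite /entry_stage -(subnKC st) iotaD count_cat add0n.
rewrite (@eq_in_count _ _ predT) ?count_predT ?size_iota; last first.
  by move=> k; rewrite mem_iota => /andP[_ /mins ->].
rewrite (@eq_in_count _ _ pred0) ?count_pred0 ?addn0// => k.
by rewrite mem_iota => /andP[le _]; rewrite (halt_stage_mono le hs).
Qed.

Lemma entry_stage_eq (i t t' : nat) : halt_stage i t -> halt_stage i t' ->
  entry_stage i t = entry_stage i t'.
Proof.
move=> /entry_stageP[h _ m] /entry_stageP[h' _ m'].
case: (ltngtP (entry_stage i t) (entry_stage i t')) => // [/m'|/m].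
- by rewrite h.
- by rewrite h'.
Qed.

Definition picked (c i t : nat) : seq (nat * (nat * bitseq)) :=
  let n := entry_stage i t in
  picks n i (level_defined c n) (level_of c n) t.

Lemma picked_sub (c i t t' : nat) : halt_stage i t -> t <= t' ->
  {subset picked c i t <= picked c i t'}.
Proof.
move=> h le; rewrite /picked -(entry_stage_eq h (halt_stage_mono le h)).
exact: picks_sub.
Qed.

(** * A prefix-free machine compressing the selected strings *)

Definition bits_val (s : bitseq) : nat := foldl (fun v (b : bool) => v.*2 + b) 0 s.

Lemma bits_val_rcons (s : bitseq) (b : bool) :
  bits_val (rcons s b) = (bits_val s).*2 + b.
Proof. by rewrite /bits_val foldl_rcons. Qed.

(** In terms of dyadic intervals: the interval of an extension lies inside that of the string. *)
Lemma bits_val_cat (s t : bitseq) :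
  bits_val s * 2 ^ size t <= bits_val (s ++ t) < (bits_val s).+1 * 2 ^ size t.
Proof.
elim/last_ind: t => [|t b IH]; first by rewrite cats0 !muln1 !leqnn.
rewrite -rcons_cat bits_val_rcons size_rcons expnS.
move: IH; set E := 2 ^ _; move: E (bits_val s) (bits_val _) => E u v.
by case: b => /= /andP[h1 h2]; apply/andP; split; nia.
Qed.

Lemma bits_val_surj (l v : nat) : v < 2 ^ l ->
  exists s, size s = l /\ bits_val s = v.
Proof.
elim: l v => [|l IH] v; first by case: v => // _; exists [::].
rewrite expnS => lt; have [s [hs hv]] : exists s, size s = l /\ bits_val s = v./2.
  by apply: IH; lia.
exists (rcons s (odd v)); rewrite size_rcons hs bits_val_rcons hv.
by split=> //; rewrite addnC odd_double_half.
Qed.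

(* [s] names a dyadic interval inside the interval of length [weight] starting
   at [a.1], all scaled by [2 ^ (3 * n)]. *)
Definition codes (n i : nat) (s : bitseq) (a : nat * (nat * bitseq)) : bool :=
  let w := weight n i a.2.1 in
  [&& 2 * 2 ^ (3 * n) == 2 ^ size s * w, 2 * a.1 <= bits_val s * w
    & (bits_val s).+1 * w <= 2 * (a.1 + w)].

Lemma weight_gt0 (n i m : nat) : 0 < weight n i m.
Proof. by rewrite expn_gt0. Qed.

(** The dyadic intervals in question have half the length of the interval of the entry, so an
    aligned one fits inside. Halving costs the bit [+ 1] in the length. *)
Lemma codes_exists (n i : nat) (conv : bitseq -> bool) (lev : bitseq -> seq bitseq)
    (conv_mono : forall tau tau', prefix tau tau' -> conv tau ->
      conv tau' /\ lev tau' = lev tau) (t : nat) a :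
  a \in picks n i conv lev t ->
  exists s, codes n i s a /\
    size s + a.2.1 + 2 * i = n + 2 * trunc_log 2 a.2.1 + 1.
Proof.
move=> ha; have [hm mn _ tot] := picks_mem ha.
have := leq_trans tot (total_weight_le n i conv_mono t).
case: a {ha tot} hm mn => P [m x] /= hm mn tot; set k := trunc_log 2 m.
have m0 : 0 < m by apply: leq_trans hm; rewrite expn_gt0.
have km : k < m by apply: leq_trans (@trunc_logP 2 m isT m0); exact: ltn_expl.
(* Together with [m <= n], this keeps the subtractions in the code length
   [n + 2 * k + 1 - m - 2 * i] from being truncated. *)
have ik : 3 * i + 2 <= k by rewrite -(@trunc_expnK 2 (3 * i + 2))//; apply: leq_trunc_log.
have ew : 2 ^ (n + 2 * k + 1 - m - 2 * i) * weight n i m = 2 * 2 ^ (3 * n).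
  by rewrite /weight -expnD -expnS -/k; congr (2 ^ _); lia.
have w0 := weight_gt0 n i m; move: ew tot w0; set w := weight n i m => ew tot w0.
(* The left end [P], rounded up to the grid of step [w / 2]. *)
pose v := (2 * P + w.-1) %/ w.
have v1 : v * w <= 2 * P + w.-1 by exact: leq_trunc_div.
have v2 : 2 * P + w.-1 < v.+1 * w by exact: ltn_ceil.
have [s [hs hv]] : exists s, size s = n + 2 * k + 1 - m - 2 * i /\ bits_val s = v.
  by apply: bits_val_surj; rewrite -(ltn_pmul2r w0) ew; lia.
exists s; split; last by rewrite hs; lia.
by rewrite /codes /= -/w hs hv ew eqxx/=; apply/andP; split; lia.
Qed.

(** If [s'] extends [s], its interval lies inside that of [s], which is impossible for entries with
    disjoint intervals. For a single entry, the weight fixes the length of the code. *)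
Lemma codes_disjoint (n i : nat) (conv : bitseq -> bool) (lev : bitseq -> seq bitseq)
    (t : nat) a a' (s s' : bitseq) :
  a \in picks n i conv lev t -> a' \in picks n i conv lev t ->
  codes n i s a -> codes n i s' a' -> prefix s s' -> a = a' /\ s = s'.
Proof.
move=> ha ha' /and3P[/eqP e1 l1 r1] /and3P[/eqP e2 l2 r2] /prefixP[u us].
have w0 := weight_gt0 n i a.2.1; have w0' := weight_gt0 n i a'.2.1.
have /andP[b1 b2] := bits_val_cat s u; rewrite -us in b1 b2.
have := picks_disjoint ha ha'.
move: w0 w0' e1 l1 r1 e2 l2 r2.
set w := weight n i a.2.1; set w' := weight n i a'.2.1 => w0 w0' e1 l1 r1 e2 l2 r2.
have ew : w = 2 ^ size u * w'.
  apply/eqP; rewrite -(eqn_pmul2l (expn_gt0 2 (size s))) -e1 e2 us size_cat expnD.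
  by rewrite mulnA.
have c1 : bits_val s * w <= bits_val s' * w' by rewrite ew mulnA leq_mul2r b1 orbT.
have c2 : (bits_val s').+1 * w' <= (bits_val s).+1 * w.
  by rewrite ew mulnA leq_mul2r b2 orbT.
case=> [ea|le|le]; [ | lia | lia].
split=> //; move: ew; rewrite /w /w' ea -[X in X = _]mul1n => /eqP.
rewrite eqn_pmul2r ?weight_gt0// -[1]/(2 ^ 0) eqn_exp2l// eq_sym size_eq0 => /eqP u0.
by rewrite us u0 cats0.
Qed.

(** The unary header makes descriptions for distinct [i] incomparable. It costs [i + 1] bits out of
    the [2 * i] gained by the weights, leaving a saving of about [i]. *)
Definition description (i : nat) (s : bitseq) : bitseq := nseq i true ++ false :: s.

Lemma prefix_description (i i' : nat) (s s' : bitseq) :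
  prefix (description i s) (description i' s') -> i = i' /\ prefix s s'.
Proof.
rewrite /description; elim: i i' => [|i IH] [|i'] //=.
by move=> /IH[->].
Qed.

Definition outputs (c x t : nat) : seq nat :=
  flatten [seq flatten [seq
      if (x == str_num (description i s)) && halt_stage i t
      then [seq str_num a.2.2 |
             a <- [seq a <- picked c i t | codes (entry_stage i t) i s a]]
      else [::]
    | s <- flatten [seq words l | l <- iota 0 t.+1]] | i <- iota 0 t].

Lemma outputsP (c x t y : nat) :
  reflect (exists i s a, [/\ size s <= t, x = str_num (description i s),
      halt_stage i t, a \in picked c i t /\ codes (entry_stage i t) i s a
      & y = str_num a.2.2])
    (y \in outputs c x t).
Proof.
apply: (iffP flatten_mapP) => [[i hi /flatten_mapP[s hs]]|].
  case: ifP => // /andP[/eqP -> h] /mapP[a]; rewrite mem_filter => /andP[h1 h2] ->.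
  exists i, s, a; split=> //.
  move: hs => /flatten_mapP[l].
  by rewrite mem_iota ltnS mem_words => /andP[_ lt] /eqP ->.
move=> [i [s [a [hs -> h [ha hc] ->]]]]; exists i.
  by rewrite mem_iota (halt_stage_lt h).
apply/flatten_mapP; exists s.
  by apply/flatten_mapP; exists (size s); rewrite ?mem_iota ?ltnS ?mem_words.
by rewrite eqxx h; apply/mapP; exists a => //; rewrite mem_filter hc.
Qed.

(** Serves twice: for prefix-freeness of the machine and, with [p = p'], to see that the output does
    not depend on the stage. The two entries are compared at the later stage. *)
Lemma outputs_prefix (c t t' y y' : nat) (p p' : bitseq) :
  y \in outputs c (str_num p) t -> y' \in outputs c (str_num p') t' ->
  prefix p p' -> p = p' /\ y = y'.
Proof.
move=> /outputsP[i [s [a [_ /str_num_inj-> h [ha hc] ->]]]].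
move=> /outputsP[i' [s' [a' [_ /str_num_inj-> h' [ha' hc'] ->]]]].
move=> /prefix_description[ei pre]; subst i'.
have m1 := picked_sub h (leq_maxl t t') ha.
have m2 := picked_sub h' (leq_maxr t t') ha'.
have hm := halt_stage_mono (leq_maxl t t') h.
rewrite (entry_stage_eq h hm) in hc; rewrite (entry_stage_eq h' hm) in hc'.
by have [-> ->] := codes_disjoint m1 m2 hc hc' pre.
Qed.

(** * Computability of the selection and existence of the compressing machine *)

Lemma cf_words {G : Type} {cG : codable G} (n : G -> nat) :
  computable n -> computable (fun x => words (n x)).
Proof. by move=> hn; apply: cf_iter; cf_auto. Qed.

#[global] Hint Resolve cf_words : computable.

Lemma cf_level_defined {G : Type} {cG : codable G} (c : nat) (n : G -> nat)
    (tau : G -> bitseq) :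
  computable n -> computable tau ->
  computable (fun x => level_defined c (n x) (tau x)).
Proof.
move=> hn htau; have h : computable (fun p : nat * bitseq => level_defined c p.1 p.2).
  by rewrite /level_defined; cf_auto.
by apply: (cf_comp (f := fun x => (n x, tau x)) h); cf_auto.
Qed.

Lemma cf_level_of {G : Type} {cG : codable G} (c : nat) (n : G -> nat)
    (tau : G -> bitseq) :
  computable n -> computable tau ->
  computable (fun x => level_of c (n x) (tau x)).
Proof.
move=> hn htau; have h : computable (fun p : nat * bitseq => level_of c p.1 p.2).
  by rewrite /level_of; cf_auto.
by apply: (cf_comp (f := fun x => (n x, tau x)) h); cf_auto.
Qed.

Lemma cf_entry_stage {G : Type} {cG : codable G} (i t : G -> nat) :
  computable i -> computable t -> computable (fun x => entry_stage (i x) (t x)).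
Proof.
move=> hi ht; have h : computable (fun p : nat * nat => entry_stage p.1 p.2).
  by rewrite /entry_stage; cf_auto.
by apply: (cf_comp (f := fun x => (i x, t x)) h); cf_auto.
Qed.

#[global] Hint Resolve cf_level_defined cf_level_of cf_entry_stage : computable.

Lemma cf_hit {G : Type} {cG : codable G} (c : nat) (n : G -> nat)
    (W : G -> seq (nat * (nat * bitseq))) (tau : G -> bitseq) :
  computable n -> computable W -> computable tau ->
  computable (fun x => hit (level_of c (n x)) (W x) (tau x)).
Proof.
move=> hn hW htau.
have h : computable (fun p : nat * (seq (nat * (nat * bitseq)) * bitseq) =>
    hit (level_of c p.1) p.2.1 p.2.2).
  by rewrite /hit /log_card; cf_auto.
by apply: (cf_comp (f := fun x => (n x, (W x, tau x))) h); cf_auto.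
Qed.

Lemma cf_weight {G : Type} {cG : codable G} (n i m : G -> nat) :
  computable n -> computable i -> computable m ->
  computable (fun x => weight (n x) (i x) (m x)).
Proof. by move=> hn hi hm; rewrite /weight; cf_auto. Qed.

#[global] Hint Resolve cf_hit cf_weight : computable.

Lemma cf_picks {G : Type} {cG : codable G} (c : nat) (n i t : G -> nat) :
  computable n -> computable i -> computable t -> computable (fun x =>
    picks (n x) (i x) (level_defined c (n x)) (level_of c (n x)) (t x)).
Proof.
move=> hn hi ht.
have hload : computable (fun p : nat * nat * seq (nat * (nat * bitseq)) * (nat * bitseq) =>
    load (level_defined c p.1.1.1) (level_of c p.1.1.1) p.1.1.2 p.1.2 p.2.1 p.2.2).
  by rewrite /load /log_card; cf_auto.
have htotal : computable (fun p : nat * nat * seq (nat * (nat * bitseq)) =>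
    total_weight p.1.1 p.1.2 p.2) by rewrite /total_weight; cf_auto.
have hpairs : computable (fun p : nat * nat => pairs p.1 p.2).
  by rewrite /pairs /min_log; cf_auto.
have hpick : computable (fun p : nat * nat * nat *
      (seq (nat * (nat * bitseq)) * (nat * bitseq)) =>
    pick_step p.1.1.1 p.1.1.2 (level_defined c p.1.1.1) (level_of c p.1.1.1)
      p.1.2 p.2.1 p.2.2).
  rewrite /pick_step; apply: cf_if.
  - apply: cf_leq; first cf_auto.
    apply: cf_mul; last cf_auto.
    apply: (cf_comp (f := fun p : nat * nat * nat *
      (seq (nat * (nat * bitseq)) * (nat * bitseq)) =>
      (p.1.1.1, p.1.2, p.2.1, p.2.2)) hload); cf_auto.
  - apply: cf_cons; last cf_auto.
    apply: cf_pair; last cf_auto.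
    apply: (cf_comp (f := fun p : nat * nat * nat *
      (seq (nat * (nat * bitseq)) * (nat * bitseq)) =>
      (p.1.1, p.2.1)) htotal); cf_auto.
  - cf_auto.
have h : computable (fun p : nat * nat * nat => picks p.1.1 p.1.2
    (level_defined c p.1.1) (level_of c p.1.1) p.2).
  apply: cf_iteri; [cf_auto | | cf_auto].
  apply: cf_foldl; [ | | cf_auto].
  - apply: (cf_comp (f := fun p : nat * nat * nat *
      (nat * seq (nat * (nat * bitseq))) => p.1.1) hpairs); cf_auto.
  - apply: (cf_comp (f := fun p : nat * nat * nat *
      (nat * seq (nat * (nat * bitseq))) *
      (seq (nat * (nat * bitseq)) * (nat * bitseq)) =>
      (p.1.1.1, p.1.2.1, p.2)) hpick); cf_auto.
by apply: (cf_comp (f := fun x => (n x, i x, t x)) h); cf_auto.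
Qed.

#[global] Hint Resolve cf_picks : computable.

Lemma cf_picked {G : Type} {cG : codable G} (c : nat) (i t : G -> nat) :
  computable i -> computable t -> computable (fun x => picked c (i x) (t x)).
Proof. by move=> hi ht; rewrite /picked; cf_auto. Qed.

#[global] Hint Resolve cf_picked : computable.

Lemma cf_outputs (c : nat) :
  computable (fun p : nat * nat => outputs c p.1 p.2).
Proof.
have hd : computable (fun p : nat * bitseq => description p.1 p.2).
  by rewrite /description; cf_auto.
have hc : computable (fun p : nat * nat * bitseq * (nat * (nat * bitseq)) =>
    codes p.1.1.1 p.1.1.2 p.1.2 p.2).
  by rewrite /codes /bits_val; cf_auto.
rewrite /outputs; apply: cf_flatten; apply: cf_map; first cf_auto.
apply: cf_flatten; apply: cf_map; first cf_auto.
apply: cf_if; last cf_auto.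
- apply: cf_and; last cf_auto.
  apply: cf_eq; first cf_auto.
  apply: cf_str_num.
  by apply: (cf_comp (f := fun p : nat * nat * nat * bitseq => (p.1.2, p.2)) hd); cf_auto.
- apply: cf_map; last cf_auto.
  apply: cf_filter; first cf_auto.
  apply: (cf_comp (f := fun p : nat * nat * nat * bitseq * (nat * (nat * bitseq)) =>
    ((entry_stage p.1.1.2 p.1.1.1.2, p.1.1.2), p.1.2, p.2)) hc); cf_auto.
Qed.

Lemma picked_complexity (U : prog) (c : nat) : optimal_prefix_free_machine U ->
  exists b, forall i t a, halt_stage i t -> a \in picked c i t ->
    exists2 p, machine U p a.2.2 &
      size p + a.2.1 + i <= entry_stage i t + 2 * trunc_log 2 a.2.1 + b.
Proof.
move=> [_ opt]; have [M hM] := first_output_machine (cf_outputs c).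
have hout p k : outputs c (str_num p) k != [::] ->
    head 0 (outputs c (str_num p) k) \in outputs c (str_num p) k.
  by case: (outputs _ _ _) => //= a l _; rewrite mem_head.
have [|b hb] := opt M.
  move=> p p' [y /hM[k [hk _ _]]] [y' /hM[k' [hk' _ _]]] pre.
  by have [] := outputs_prefix (hout _ _ hk) (hout _ _ hk') pre.
(* One bit for the separator after the header, one for the halving of the interval, and the coding
   constant [b] of the machine. *)
exists (2 + b) => i t a h ha.
have [s [hs es]] := codes_exists (@level_of_mono c (entry_stage i t)) ha.
have [|p hp le] := hb (description i s) a.2.2.
  (* By stage [T] both the entry and the code [s] are found. *)
  apply/hM; set T := maxn t (size s).
  have mem : str_num a.2.2 \in outputs c (str_num (description i s)) T.
    have hT := halt_stage_mono (leq_maxl t (size s)) h.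
    apply/outputsP; exists i, s, a; split=> //; first exact: leq_maxr.
    split; first by apply: picked_sub ha => //; exact: leq_maxl.
    by rewrite -(entry_stage_eq h hT).
  (* The machine stops at the first stage with an output, possibly before [T], but with the same
     output. *)
  have [|k [hk mk]] := @ex_least (fun k => outputs c (str_num (description i s)) k != [::]).
    by exists T; apply/eqP => e; rewrite e in mem.
  exists k; split=> // [j /mk/negPn/eqP//|].
  by have [_ ->] := outputs_prefix mem (hout _ _ hk) (prefix_refl _).
exists p => //; move: le es; rewrite /description size_cat size_nseq /=; lia.
Qed.

(** * The Martin-Loef test *)

Lemma sum_geometric_bound (f : nat -> nat) (C j t : nat) :
  (forall i, j < i < t -> f i * 2 ^ i <= C) ->
  (\sum_(j.+1 <= i < t) f i) * 2 ^ j <= C.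
Proof.
case: (leqP t j.+1) => [le|lt]; first by rewrite big_geq.
have -> : t = j.+1 + (t - j.+1) by lia.
move: (t - j.+1) => d hf.
(* The summand [C] accounts for the rest of the geometric series and makes the induction go
   through. *)
suff h : (\sum_(j.+1 <= i < j.+1 + d) f i) * 2 ^ j * 2 ^ d + C <= C * 2 ^ d.
  have E0 : 0 < 2 ^ d by rewrite expn_gt0.
  by rewrite -(leq_pmul2r E0); apply: leq_trans h; exact: leq_addr.
elim: d hf => [|d IH] hf; first by rewrite addn0 big_geq// expn0 !muln1.
have hd : f (j.+1 + d) * 2 ^ (j.+1 + d) <= C by apply: hf; lia.
have {}IH := IH (fun i hi => hf i ltac:(lia)).
rewrite addnS big_nat_recr ?leq_addr//=.
move: IH hd; rewrite addSn !expnS expnD.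
move: (\sum_(_ <= _ < _) _) (f _) (2 ^ j) (2 ^ d).
by move=> S F E G; nia.
Qed.

(** Stage [(size tau).+1] of the selection is the one that has processed the words of length
    [size tau]. *)
Definition waits (c i : nat) (tau : bitseq) : bool :=
  let n := entry_stage i (size tau) in
  halt_stage i (size tau) &&
  waiting i (level_defined c n) (level_of c n) (picked c i (size tau).+1) tau.

Lemma entry_stageS (i t : nat) : halt_stage i t -> entry_stage i t.+1 = entry_stage i t.
Proof. by move=> h; apply: entry_stage_eq => //; exact: halt_stage_mono h. Qed.

Lemma count_waits (c i t : nat) : count (waits c i) (words t) * 2 ^ i <= 2 ^ t.
Proof.
case h : (halt_stage i t); last first.
  rewrite (@eq_in_count _ _ pred0) ?count_pred0// => tau.
  by rewrite mem_words /waits => /eqP ->; rewrite h.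
pose n := entry_stage i t.
rewrite (@eq_in_count _ _ (waiting i (level_defined c n) (level_of c n)
    (picks n i (level_defined c n) (level_of c n) t.+1))).
  by apply: count_waiting; [exact: level_of_uniq | exact: level_of_words].
move=> tau; rewrite mem_words /waits => /eqP ->.
by rewrite h /picked entry_stageS.
Qed.

(* [j] enters the halting problem at stage [size tau], while [tau] waits for
   some larger number. *)
Definition alarm (c j : nat) (tau : bitseq) : bool :=
  [&& halt_stage j (size tau), entry_stage j (size tau) == size tau
    & has (fun i => (j < i) && waits c i tau) (iota 0 (size tau))].

(** Union bound: waiting for [i] has measure at most [2 ^ - i], and these bounds for [i > j] add up
    to at most [2 ^ - j]. *)
Lemma count_alarm (c j t : nat) : count (alarm c j) (words t) * 2 ^ j <= 2 ^ t.
Proof.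
apply: (@leq_trans ((\sum_(j.+1 <= i < t) count (waits c i) (words t)) * 2 ^ j)).
  rewrite leq_mul2r; apply/orP; right.
  under eq_bigr do rewrite -sum1_count big_mkcond.
  rewrite exchange_big /= -sum1_count big_mkcond /= !big_seq.
  apply: leq_sum => tau; rewrite mem_words => /eqP st; case: ifP => //.
  rewrite /alarm st => /and3P[_ _ /hasP[i]]; rewrite mem_iota add0n => it /andP[ji hi].
  rewrite (@big_cat_nat _ _ _ i) ?(ltnW it)//= (@big_ltn _ _ _ i)// hi.
  lia.
by apply: sum_geometric_bound => i _; exact: count_waits.
Qed.

Definition late_test (c k : nat) (tau : bitseq) : bool :=
  has (fun j => (k < j) && alarm c j tau) (iota 0 (size tau)).

Section Measure.
Variable R : realType.
Local Open Scope ring_scope.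

(** All alarms for [j] have the same length, namely the stage at which [j] enters, so a count at
    that one length suffices. *)
Lemma sum_alarm (c j : nat) (F : seq bitseq) : uniq F -> all (alarm c j) F ->
  \sum_(tau <- F) (2^-1 : R) ^+ size tau <= 2^-1 ^+ j.
Proof.
case: F => [|tau0 F]; first by rewrite big_nil exprn_ge0// invr_ge0.
move=> uF aF; pose t := size tau0; set G := tau0 :: F in uF aF *.
have sG tau : tau \in G -> size tau = t.
  move=> hG; have /and3P[h /eqP e _] := allP aF _ hG.
  have /andP[/and3P[h0 /eqP e0 _] _] := aF.
  by rewrite /t -e -e0; exact: entry_stage_eq.
rewrite big_seq (eq_bigr (fun=> 2^-1 ^+ t)) => [|tau /sG ->//].
rewrite -big_seq big_const_seq count_predT iter_addr_0.
rewrite -[leLHS]mulr_natl exprVn exprVn ler_pdivrMr ?exprn_gt0//.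
rewrite -(@ler_pM2r _ (2 ^+ j)) ?exprn_gt0// mulrAC mulVf ?expf_neq0// mul1r.
rewrite -!natrX -natrM ler_nat.
apply: leq_trans (count_alarm c j t); rewrite leq_mul2r; apply/orP; right.
rewrite -size_filter; apply: uniq_leq_size => // tau hG.
by rewrite mem_filter (allP aF _ hG) mem_words sG ?eqxx.
Qed.

Lemma sum_late_test (c k : nat) (F : seq bitseq) : uniq F -> all (late_test c k) F ->
  \sum_(tau <- F) (2^-1 : R) ^+ size tau <= 2^-1 ^+ k.
Proof.
move=> uF aF; pose J := (\max_(tau <- F) size tau)%N.
have ge0 (n : nat) : 0 <= (2^-1 : R) ^+ n by rewrite exprn_ge0// invr_ge0.
(* Union bound over [j > k]; an alarm for [j] is longer than [j], so [J] bounds the relevant [j]. *)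
apply: (@le_trans _ _ (\sum_(k.+1 <= j < J)
    \sum_(tau <- F | alarm c j tau) 2^-1 ^+ size tau)).
  under [leRHS]eq_bigr do rewrite big_mkcond.
  rewrite exchange_big /= big_seq [leRHS]big_seq; apply: ler_sum => tau hF.
  have /hasP[j] := allP aF _ hF; rewrite mem_iota add0n => jt /andP[kj hj].
  have jJ : (j < J)%N by apply: leq_trans jt _; exact: (@leq_bigmax_seq _ _ xpredT size).
  rewrite (@big_cat_nat _ _ _ j) ?(ltnW jJ)//= (@big_ltn _ _ _ j)// hj.
  rewrite addrCA lerDl addr_ge0// sumr_ge0// => l _; case: ifP => //.
apply: (@le_trans _ _ (\sum_(k.+1 <= j < J) (2^-1 : R) ^+ j)).
  apply: ler_sum => j _; rewrite -big_filter; apply: sum_alarm; first exact: filter_uniq.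
  exact: filter_all.
case: (leqP J k.+1) => [le|lt]; first by rewrite big_geq.
rewrite -(subnKC (ltnW lt)); move: (J - k.+1)%N => d.
suff h : \sum_(k.+1 <= j < k.+1 + d) (2^-1 : R) ^+ j + 2^-1 ^+ (k + d) <= 2^-1 ^+ k.
  by apply: le_trans h; rewrite lerDl.
elim: d => [|d IH]; first by rewrite addn0 big_geq// add0r addn0.
rewrite addnS big_nat_recr ?leq_addr//= addrAC -addrA.
by apply: le_trans IH; rewrite lerD2l addnS addSn exprSr -splitr.
Qed.

Lemma late_test_ML (c : nat) :
  ML_test R (fun k => [set tau | late_test c k tau]%classic).
Proof.
split.
  have hw : computable (fun p : nat * bitseq => waits c p.1 p.2).
    by rewrite /waits /waiting /min_log /log_card; cf_auto.
  have ht : computable (fun p : nat * bitseq => late_test c p.1 p.2).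
    have ha : computable (fun p : nat * bitseq => alarm c p.1 p.2).
      rewrite /alarm; apply: cf_and; first cf_auto.
      apply: cf_and; first cf_auto.
      apply: cf_has; first cf_auto.
      apply: cf_and; first cf_auto.
      by apply: (cf_comp (f := fun p : nat * bitseq * nat => (p.2, p.1.2)) hw); cf_auto.
    rewrite /late_test; apply: cf_has; first cf_auto.
    apply: cf_and; first cf_auto.
    by apply: (cf_comp (f := fun p : nat * bitseq * nat => (p.2, p.1.2)) ha); cf_auto.
  have hD : computable (fun p : nat * nat => has (fun k => has (fun tau =>
      (p.1 == cpair k (str_num tau)) && late_test c k tau)
      (flatten [seq words l | l <- iota 0 p.2])) (iota 0 p.2)).
    apply: cf_has; first cf_auto.
    apply: cf_has; first cf_auto.
    apply: cf_and; first cf_auto.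
    by apply: (cf_comp (f := fun p : nat * nat * nat * bitseq => (p.1.2, p.2)) ht); cf_auto.
  have := comp_enum_search (D := fun x t => has (fun k => has (fun tau =>
      (x == cpair k (str_num tau)) && late_test c k tau)
      (flatten [seq words l | l <- iota 0 t])) (iota 0 t)) hD.
  congr comp_enum; apply/seteqP; split => x /=.
  - move=> [t /hasP[k _ /hasP[tau _ /andP[/eqP -> h]]]].
    by exists k, tau.
  - move=> [k [tau [h ->]]]; exists (maxn k (size tau)).+1.
    apply/hasP; exists k; first by rewrite mem_iota; lia.
    apply/hasP; exists tau; last by rewrite eqxx.
    by apply/flatten_mapP; exists (size tau); rewrite ?mem_words// mem_iota; lia.
move=> k; apply: (@le_trans _ _ (\esum_(s in [set tau | late_test c k tau]%classic)
    ((2^-1 : R) ^+ size s)%:E)%E).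
  by apply: ereal_inf_lbound; exists [set tau | late_test c k tau]%classic.
(* The infinite sum is the supremum of its finite partial sums, to which [sum_late_test] applies. *)
apply: ge_ereal_sup => _ [F [finF subF] <-].
rewrite fsbig_finite//= sumEFin lee_fin; apply: (@sum_late_test c).
  exact: finmap.fset_uniq.
by apply/allP => tau; rewrite in_fset_set// => /set_mem/subF.
Qed.

Lemma random_no_alarm (c : nat) (z : nat -> bool) : ML_random R z ->
  exists k, forall j t, (k < j)%N -> ~~ alarm c j (mkseq z t).
Proof.
move=> /(_ _ (late_test_ML c)) h.
have [k hk] : exists k, ~ open_of [set tau | late_test c k tau]%classic z.
  by apply: contrapT => /forallNP hn; apply: h => k _; apply: contrapT; exact: hn.
exists k => j t kj; apply/negP => hj; apply: hk.
exists (mkseq z t); last by rewrite /cylinder /= size_mkseq.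
apply/hasP; exists j; last by rewrite kj.
by rewrite mem_iota; case/and3P: hj => /halt_stage_lt.
Qed.

End Measure.

(** * Levels of the tree *)

Definition tree_level (T : set bitseq) (n : nat) : seq bitseq :=
  [seq s <- words n | `[< T s >]].

Lemma mem_tree_level (T : set bitseq) (n : nat) (s : bitseq) :
  (s \in tree_level T n) = `[< T s >] && (size s == n).
Proof. by rewrite mem_filter mem_words. Qed.

Lemma size_tree_level (T : set bitseq) (n : nat) :
  size (tree_level T n) = level_card T n.
Proof.
rewrite /level_card cardE -(size_map val); apply/perm_size/uniq_perm.
- by rewrite filter_uniq ?uniq_words.
- by rewrite map_inj_uniq ?enum_uniq//; exact: val_inj.
move=> s; rewrite mem_tree_level; apply/andP/mapP.
- move=> [hT hs]; exists (Tuple hs) => //.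
  by rewrite mem_enum.
- by move=> [t]; rewrite mem_enum => ht ->; rewrite size_tuple.
Qed.

(** In a pruned tree every string of length [n] extends to one of length [n.+1], so truncation maps
    the higher level onto the lower one. *)
Lemma tree_level_leS (T : set bitseq) (n : nat) : tree T -> pruned T ->
  size (tree_level T n) <= size (tree_level T n.+1).
Proof.
move=> [_ down] pru.
rewrite -(size_map (take n) (tree_level T n.+1)); apply: uniq_leq_size.
  by rewrite filter_uniq ?uniq_words.
move=> s; rewrite mem_tree_level => /andP[/asboolP Ts /eqP sn].
have [t [Tt pst ts]] : exists t, [/\ T t, prefix s t & t <> s].
  apply: contrapT => h; apply: pru; exists s => // t Tt pst.
  by apply: contrapT => ts; apply: h; exists t.
have lt : n < size t.
  move: pst ts => /prefixP[[|b u] ->]; rewrite ?cats0// => _.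
  by rewrite size_cat sn /= addnS ltnS leq_addr.
apply/mapP; exists (take n.+1 t).
  rewrite mem_tree_level size_takel// eqxx andbT; apply/asboolP.
  by apply: down Tt; exact: prefix_take.
rewrite take_takel//; move: pst => /prefixP[u ->].
by rewrite take_size_cat.
Qed.

Lemma tree_level_le (T : set bitseq) (n n' : nat) : tree T -> pruned T ->
  n <= n' -> size (tree_level T n) <= size (tree_level T n').
Proof.
move=> hT hp /subnKC <-; elim: (n' - n) => [|d IH]; first by rewrite addn0.
by rewrite addnS (leq_trans IH)// tree_level_leS.
Qed.

Section OracleLevels.
Variables (T : set bitseq) (z : nat -> bool) (e : prog).
Hypothesis he : forall n, oracle_eval z e n (charf (str_num @` T)%classic n).

Lemma charf_tree (s : bitseq) : charf (str_num @` T)%classic (str_num s) = `[< T s >].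
Proof.
apply/idP/idP => /asboolP h; apply/asboolP; last by exists s.
by case: h => t Tt /str_num_inj <-.
Qed.

Lemma level_of_oracle (n t : nat) : level_defined (prog_num e) n (mkseq z t) ->
  level_of (prog_num e) n (mkseq z t) = tree_level T n.
Proof.
move=> /allP h; apply: eq_in_filter => s /h hs; rewrite -charf_tree.
have key b : evals (mkseq z t) (prog_num e) (str_num s) b ->
    b = charf (str_num @` T)%classic (str_num s).
  by move=> /evals_sound hb; exact: oracle_eval_fun hb (he _).
case/orP: hs => hb.
- rewrite -[charf _ _ in RHS]lt0b -(key _ hb); apply/negbTE/negP => /(evals_fun hb).
  by [].
- by rewrite hb -[charf _ _ in RHS]lt0b -(key _ hb).
Qed.

Lemma level_defined_mono (n t t' : nat) : t <= t' ->
  level_defined (prog_num e) n (mkseq z t) -> level_defined (prog_num e) n (mkseq z t').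
Proof. by move=> /(prefix_mkseq z) /level_of_mono h /h[]. Qed.

Lemma level_defined_oracle (n : nat) :
  exists t, level_defined (prog_num e) n (mkseq z t).
Proof.
rewrite /level_defined; elim: (words n) => [|s l [t IH]]; first by exists 0.
have [t' h] := evals_complete (he (str_num s)).
exists (maxn t t') => /=; apply/andP; split.
  have := evals_mkseq_mono (leq_maxr t t') h.
  by case: (charf _ _) => -> //; rewrite orbT.
apply/allP => u /(allP IH) /orP[] hu; apply/orP; [left|right].
- exact: evals_mkseq_mono (leq_maxl _ _) hu.
- exact: evals_mkseq_mono (leq_maxl _ _) hu.
Qed.

End OracleLevels.

(** * Deciding the halting problem by certificates *)

(** A certificate of length [k] guarantees that [x] enters by stage [k] if at all, so the answer is
    [halt_stage x k]. The numbers below [I] are answered by a finite table. *)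
Lemma halting_le_search (z : nat -> bool) (I : nat) (D : nat -> bitseq -> bool) :
  computable (fun p : nat * bitseq => D p.1 p.2) ->
  (forall x, I <= x -> exists k, D x (mkseq z k)) ->
  (forall x k, I <= x -> D x (mkseq z k) -> halting_problem x -> halt_stage x k) ->
  turing_le (charf halting_problem) z.
Proof.
move=> hD ex sound.
pose table := mkseq (charf halting_problem) I.
apply: (@turing_le_search (fun x tau => (x < I) || D x tau)
  (fun x tau => if x < I then nth false table x else halt_stage x (size tau))).
- by cf_auto.
- by cf_auto.
- move=> x; case: (ltnP x I) => [lt|/ex[k hk]]; last by exists k.
  by exists 0.
- move=> x k; case: (ltnP x I) => [lt _|le /= h]; first by rewrite nth_mkseq.
  rewrite size_mkseq; apply/idP/asboolP => [hs|]; last exact: sound h.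
  by apply/halting_problemP; exists k.
Qed.

(** * From the deficiency hypothesis to a lower bound on descriptions *)

Section Deficiency.
Variables (R : realType) (U : prog) (T : set bitseq).
Hypothesis hdef : forall n : nat, 2 <= level_card T n ->
  ((2 * log2 (log2 ((level_card T n)%:R : R)))%:E
        + deficiency R U (level T n)
      <= (log2 ((level_card T n)%:R : R))%:E)%E.
Local Open Scope ring_scope.

Lemma log2_ler (x y : R) : 0 < x -> x <= y -> log2 x <= log2 y.
Proof.
move=> x0 xy; rewrite /log2 ler_pM2r ?invr_gt0 ?ln_gt0 ?ltr1n//.
by rewrite ler_ln ?posrE// (lt_le_trans x0).
Qed.

Lemma log2_ltr (x y : R) : 0 < x -> x < y -> log2 x < log2 y.
Proof.
move=> x0 xy; rewrite /log2 ltr_pM2r ?invr_gt0 ?ln_gt0 ?ltr1n//.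
by rewrite ltr_ln ?posrE// (lt_trans x0).
Qed.

Lemma log2_expn (m : nat) : log2 ((2 ^ m)%N%:R : R) = m%:R.
Proof.
rewrite /log2 natrX lnXn ?ltr0n// -[X in X / _]mulr_natl mulfK//.
by rewrite gt_eqF// ln_gt0// ltr1n.
Qed.

(** With [a] the logarithm of the size of the level, the hypothesis gives
    [n - size p <= a - 2 * log2 a], where [a < m.+1] and [log2 a >= trunc_log 2 m]. The resulting
    strict inequality is between integers, so the fractional part of [a] costs nothing. *)
Lemma complexity_lower_bound (n m : nat) (s p : bitseq) :
  (0 < m)%N -> (2 ^ m <= level_card T n < 2 ^ m.+1)%N ->
  T s -> size s = n -> machine U p s ->
  (2 * trunc_log 2 m + n <= m + size p)%N.
Proof.
move=> m0 /andP[lo hi] Ts sn hp; set N := level_card T n in lo hi *.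
have N2 : (2 <= N)%N by apply: leq_trans lo; rewrite -{1}(expn1 2) leq_exp2l.
have := hdef N2; rewrite -/N.
set k := trunc_log 2 m; set a := log2 (N%:R : R).
have am : m%:R <= a.
  by rewrite -log2_expn; apply: log2_ler; rewrite ?ler_nat// ltr0n expn_gt0.
have am1 : a < m.+1%:R.
  by rewrite -log2_expn; apply: log2_ltr; rewrite ?ltr_nat// ltr0n; lia.
have kl : k%:R <= log2 a.
  rewrite -(log2_expn k); apply: log2_ler; first by rewrite ltr0n expn_gt0.
  by apply: le_trans am; rewrite ler_nat; exact: trunc_logP.
(* The description [p] bounds the complexity of [s] from above. *)
have hd : ((n%:R - (size p)%:R)%:E <= deficiency R U (level T n))%E.
  apply: (@le_trans _ _ ((size s)%:R%:E - complexity R U s)%E).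
    rewrite sn EFinB leeB//; apply: ereal_inf_lbound; exists p => //.
  by apply: ereal_sup_ubound; exists s.
move=> h.
have := le_trans (leeD2l (2 * log2 a)%:E hd) h.
rewrite -EFinD lee_fin => h'.
have : (2 * k + n)%N%:R < (m.+1 + size p)%N%:R :> R.
  by rewrite natrD natrM natrD; move: am1 kl h'; lra.
by rewrite ltr_nat; lia.
Qed.

End Deficiency.

(** * The two cases: finitely or infinitely many late numbers *)

Section Main.
Variables (T : set bitseq) (z : nat -> bool) (e : prog).
Hypothesis hT : tree T.
Hypothesis hpruned : pruned T.
Hypothesis hproper : proper_tree T.
Hypothesis he : forall n, oracle_eval z e n (charf (str_num @` T)%classic n).

Let c := prog_num e.

Definition late (i : nat) : Prop := exists t, halt_stage i t /\
  2 ^ min_log i <= size (tree_level T (entry_stage i t)).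

(** The certificate is a level [n] with at least [2 ^ min_log i] strings. Levels do not shrink, so
    if [i] entered at stage [n] or later it would be late. Properness supplies such a level. *)
Lemma finitely_many_late (I : nat) :
  (forall i, I <= i -> ~ late i) -> turing_le (charf halting_problem) z.
Proof.
move=> hI; apply: (@halting_le_search z I (fun i tau => has (fun n =>
  level_defined c n tau && (2 ^ min_log i <= size (level_of c n tau)))
  (iota 0 (size tau)))).
- by rewrite /min_log; cf_auto.
- move=> i _; have [n hn] := hproper (2 ^ min_log i).
  have [t ht] := level_defined_oracle he n.
  exists (maxn t n.+1); apply/hasP; exists n.
    by rewrite mem_iota size_mkseq; lia.
  have ht' : level_defined c n (mkseq z (maxn t n.+1)).
    exact: level_defined_mono (leq_maxl _ _) ht.
  by rewrite ht' (level_of_oracle he ht') size_tree_level ltnW.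
- move=> i k Ii /hasP[n]; rewrite mem_iota size_mkseq => nk /andP[hn sn].
  move=> /halting_problemP[t ht]; have [hs _ mins] := entry_stageP ht.
  case h : (halt_stage i k) => //; case: (hI i Ii); exists t; split=> //.
  rewrite (level_of_oracle he hn) in sn; apply: leq_trans sn _.
  apply: tree_level_le => //; case: (leqP k (entry_stage i t)) => [|lt]; first lia.
  by rewrite (halt_stage_mono (ltnW lt) hs) in h.
Qed.

(** A certificate for [j] is a larger late [i] whose level is already computed from the prefix of
    [z]. As that level is never hit, [z] waits for [i] forever, and an entry of [j] from then on
    would raise an alarm. *)
Lemma infinitely_many_late (k b : nat) :
  (forall j t, k < j -> ~~ alarm c j (mkseq z t)) ->
  (forall i t, b < i -> halt_stage i t ->
    level_defined c (entry_stage i t) (mkseq z t) ->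
    ~~ hit (level_of c (entry_stage i t)) (picked c i t.+1) (mkseq z t)) ->
  (forall I, exists2 i, I <= i & late i) -> turing_le (charf halting_problem) z.
Proof.
move=> no_alarm no_hit often.
apply: (@halting_le_search z k.+1 (fun j tau => has (fun i =>
  [&& j < i, b < i, halt_stage i (size tau),
    level_defined c (entry_stage i (size tau)) tau
  & 2 ^ min_log i <= size (level_of c (entry_stage i (size tau)) tau)])
  (iota 0 (size tau)))).
- by rewrite /min_log; cf_auto.
- move=> j _; have [i hi [t [ht sz]]] := often (maxn j b).+1.
  have [t' ht'] := level_defined_oracle he (entry_stage i t).
  set t2 := maxn t t'; have h2 := halt_stage_mono (leq_maxl t t') ht.
  have hd : level_defined c (entry_stage i t) (mkseq z t2).
    exact: level_defined_mono (leq_maxr _ _) ht'.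
  exists t2; apply/hasP; exists i; rewrite size_mkseq.
    by rewrite mem_iota add0n leq0n (halt_stage_lt h2).
  rewrite -(entry_stage_eq ht h2) (level_of_oracle he hd) h2 hd sz !andbT.
  by apply/andP; split; lia.
- move=> j s kj /hasP[i _]; rewrite size_mkseq => /and5P[ji bi hi hd sz].
  move=> /halting_problemP[t ht]; have [hs _ _] := entry_stageP ht.
  (* Otherwise [j] enters at a stage [u >= s], where [z] is still waiting for [i]. *)
  case h : (halt_stage j s) => //; set u := entry_stage j t in hs.
  have su : s <= u.
    case: (leqP s u) => // lt; by rewrite (halt_stage_mono (ltnW lt) hs) in h.
  have hiu := halt_stage_mono su hi.
  have eiu := entry_stage_eq hi hiu.
  have hdu : level_defined c (entry_stage i u) (mkseq z u).
    by rewrite -eiu; exact: level_defined_mono su hd.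
  case/negP: (no_alarm j u kj); apply/and3P; rewrite size_mkseq; split=> //.
    by apply/eqP; exact: entry_stage_eq.
  apply/hasP; exists i; first by rewrite mem_iota add0n leq0n (halt_stage_lt hiu).
  rewrite ji /waits size_mkseq hiu /waiting hdu !andTb; apply/andP; split.
  + apply: trunc_log_max => //.
    by rewrite (level_of_oracle he hdu) -eiu -(level_of_oracle he hd).
  + exact: no_hit.
Qed.

(** A hit string of the tree of [z] has a short description by [picked_complexity], against
    [complexity_lower_bound]. Adding the two inequalities leaves [i <= b]. *)
Lemma no_hit (R : realType) (U : prog) (hU : optimal_prefix_free_machine U)
    (hdef : forall n : nat, 2 <= level_card T n ->
      ((2 * log2 (log2 ((level_card T n)%:R : R)))%:E
        + deficiency R U (level T n)
      <= (log2 ((level_card T n)%:R : R))%:E)%E) :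
  exists b, forall i t, b < i -> halt_stage i t ->
    level_defined c (entry_stage i t) (mkseq z t) ->
    ~~ hit (level_of c (entry_stage i t)) (picked c i t.+1) (mkseq z t).
Proof.
have [b hb] := picked_complexity c hU.
exists b => i t bi hi; set n := entry_stage i t => hd.
apply/hasPn => -[P [m s]] ha; apply/negP => /= /andP[/eqP em hs].
have hi' := halt_stage_mono (leqnSn t) hi.
have [p hp le] := hb _ _ _ hi' ha.
have en : entry_stage i t.+1 = n by exact: entry_stageS.
have [hm _ _ _] := picks_mem ha; rewrite /= in hm.
have m0 : 0 < m by apply: leq_trans hm; rewrite expn_gt0.
have := @log_card_bounds (level_of c n) (mkseq z t).
rewrite -em => /(_ m0); rewrite (level_of_oracle he hd) size_tree_level => bounds.
move: hs; rewrite (level_of_oracle he hd) mem_tree_level => /andP[/asboolP Ts /eqP sn].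
have := complexity_lower_bound hdef m0 bounds Ts sn hp.
by move: le; rewrite /= en; lia.
Qed.

End Main.

Local Open Scope ereal_scope.

Theorem theorem1p6 (R : realType) (U : prog)
    (hU : optimal_prefix_free_machine U)
    (z : nat -> bool) (hz : ML_random R z)
    (T : set bitseq) (hT : tree T) (hpruned : pruned T)
    (hproper : proper_tree T) (hzT : computes_tree z T)
    (hdef : forall n : nat, (2 <= level_card T n)%N ->
      (2 * log2 (log2 ((level_card T n)%:R : R)))%:E
        + deficiency R U (level T n)
      <= (log2 ((level_card T n)%:R : R))%:E) :
  turing_le (charf halting_problem) z.
Proof.
have [e he] := hzT.
have [b hb] := no_hit he hU hdef.
have [k hk] := random_no_alarm (prog_num e) hz.
(* The reduction is not uniform: which case holds, and the bounds [I], [b] and [k], are merely known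
   to exist. *)
have [[I hI]|many] := pselect (exists I, forall i, (I <= i)%N -> ~ late T i).
  exact: finitely_many_late hI.
apply: infinitely_many_late hk hb _ => // I; apply: contrapT => none.
by apply: many; exists I => i Ii li; apply: none; exists i.
Qed.
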